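(* Let $(\mathcal{Y}_n)_{n\ge1}$ be the Hollywood process with parameter $(\alpha,\theta,\nu)$, where $0<\alpha<1$, $\theta>-\alpha$, and $\nu=(\nu_k)_{k\ge1}$ is a probability distribution on the positive integers with finite mean $\mu=\sum_{k\ge1}k\nu_k$. Then $$E(v(\mathcal{Y}_n))\sim\frac{\Gamma(\theta+1)}{\alpha\Gamma(\theta+\alpha)}(\mu n)^\alpha\quad\text{as }n\to\infty.$$ Furthermore, if $1/\mu<\alpha<1$, then $(\mathcal{Y}_n)_{n\ge1}$ is almost surely sparse, i.e. $\limsup_{n\to\infty}e(\mathcal{Y}_n)/v(\mathcal{Y}_n)^{m_\bullet(\mathcal{Y}_n)}=0$ almost surely.
   Context: Hollywood process with parameter $(\alpha,\theta,\nu)$: generate $X_1,X_2,\dots$ as follows. For each $n$, independently draw $K_n\sim\nu$; given $K_n=k$ choose $X_{n,1},\dots,X_{n,k}$ sequentially. Let $V_n(j)$ be the number of distinct labels among $X_1,\dots,X_{n-1},X_{n,1},\dots,X_{n,j-1}$ (labels $1,2,\dots$ assigned in order of first appearance), and for $i\le V_n(j)$ let $D_{n,j}(i)$ be the number of occurrences of label $i$ among these. Then $\mathrm{pr}(X_{n,j}=i\mid\text{past})\propto D_{n,j}(i)-\alpha$ for $i=1,\dots,V_n(j)$ and $\propto\theta+\alpha V_n(j)$ for $i=V_n(j)+1$. Set $X_n=(X_{n,1},\dots,X_{n,K_n})$ and let $\mathcal{Y}_n$ be the edge-labeled network (vertex labels forgotten, edge labels $1,\dots,n$ kept) with edges $X_1,\dots,X_n$.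 For an edge-labeled network $\mathcal{E}$: $v(\mathcal{E})$ is the number of distinct vertices appearing in its edges, $e(\mathcal{E})$ its number of edges, $M_k(\mathcal{E})$ the number of edges of arity (length) $k$, and $m_\bullet(\mathcal{E})=e(\mathcal{E})^{-1}\sum_{k\ge1}kM_k(\mathcal{E})$ the average arity. $\Gamma$ is the gamma function. *)

(* Defs.v *)
From HB Require Import structures.
From mathcomp Require Import all_boot all_order all_algebra.
From mathcomp Require Import all_classical all_reals all_analysis.
Set Implicit Arguments. Unset Strict Implicit. Unset Printing Implicit Defensive.
Import Order.TTheory GRing.Theory Num.Theory.
Import numFieldNormedType.Exports.
Local Open Scope ring_scope.

Section Hollywood.
Variable R : realType.

Definition Gamma (x : R) : R :=
  fine (\int[lebesgue_measure]_(t in `]0%R : R, +oo[%classic)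
          ((t `^ (x - 1)) * expR (- t))%:E)%E.

(** An edge-labeled network is the sequence of its edges (edge i+1 is the
    i-th entry); an edge is the sequence of its vertex labels. *)
Definition network := seq (seq nat).

Definition nverts (E : network) : nat := size (undup (flatten E)).
Definition nedges (E : network) : nat := size E.
Definition Mk (E : network) (k : nat) : nat := count (fun x => size x == k) E.
(** maximal arity (all M_k vanish beyond it). *)
Definition maxarity (E : network) : nat := \max_(x <- E) size x.
Definition mbullet (E : network) : R :=
  (nedges E)%:R^-1 * \sum_(1 <= k < (maxarity E).+1) (k * Mk E k)%:R.

(** Hollywood (Pitman-Yor type) predictive probability that the next label is x,
    given the history hist of all labels drawn so far (labels 1,2,...
    in order of first appearance). When the history is empty the only possible
    label is 1 (a new one), drawn with probability 1. *)
Definition draw_prob (alpha theta : R) (hist : seq nat) (x : nat) : R :=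
  let N := size hist in
  let V := size (undup hist) in
  if N == 0%N then (x == 1%N)%:R
  else if (1 <= x <= V)%N then ((count_mem x hist)%:R - alpha) / (N%:R + theta)
  else if x == V.+1 then (theta + alpha * V%:R) / (N%:R + theta)
  else 0.

Fixpoint seq_prob (alpha theta : R) (hist : seq nat) (s : seq nat) : R :=
  match s with
  | [::] => 1
  | x :: s' => draw_prob alpha theta hist x * seq_prob alpha theta (rcons hist x) s'
  end.

(** probability that the first edges X_1,...,X_n equal es (given history hist);
    each edge: draw K ~ nu, then its K labels sequentially. *)
Fixpoint path_prob (alpha theta : R) (nu : nat -> R) (hist : seq nat)
    (es : network) : R :=
  match es with
  | [::] => 1
  | e :: es' => nu (size e) * seq_prob alpha theta hist e
                * path_prob alpha theta nu (hist ++ e) es'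
  end.

(** Y_n as a function of the sample: the edges X 0, ..., X (n-1)
    (X i is the (i+1)-th edge of the process). *)
Definition Ynet (T : Type) (X : nat -> T -> seq nat) (n : nat) (t : T) : network :=
  [seq X i t | i <- iota 0 n].

Definition is_hollywood d (T : measurableType d) (P : probability T R)
    (alpha theta : R) (nu : nat -> R) (X : nat -> T -> seq nat) : Prop :=
  (forall n (s : seq nat), measurable [set t : T | X n t = s]%classic) /\
  (forall (es : network),
      P [set t : T | Ynet X (size es) t = es]%classic = (path_prob alpha theta nu [::] es)%:E).

End Hollywood.

(* Main.v *)
Require Import Defs.
From HB Require Import structures.
From mathcomp Require Import all_boot all_order all_algebra.
From mathcomp Require Import all_classical all_reals all_analysis.
From mathcomp Require Import measurable_realfun ring lra zify.
Set Implicit Arguments.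
Unset Strict Implicit.
Import Order.TTheory GRing.Theory Num.Theory.
Import numFieldNormedType.Exports.
Local Open Scope classical_set_scope.
Local Open Scope ring_scope.

(** Let [V] and [N] be the numbers of distinct labels and of draws so far, and
    [b = theta / alpha].  For every [p > - (1 + b)] the quotient of
    [Gamma (V + b + p) / Gamma (V + b)] by
    [Gamma (N + theta + alpha p) / Gamma (N + theta)] is a martingale of the
    label draws.  As the arities are drawn independently of the labels, the
    expectation of the first ratio at [Y_n] is a constant times the expectation
    of the second one at the i.i.d. sum [N_n = K_1 + ... + K_n].

    For [p = 1] the first ratio is [V + b], and Wendel's inequalities make the
    second one [N^alpha (1 + o(1))]; Jensen's inequality and a Chernoff bound for
    the lower tail of [N_n] then give the asymptotics of the expectation.  For a
    small negative [p], Markov's inequality and the Borel-Cantelli lemma along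
    [n = 2^k] give [v(Y_n) >= (n/2)^beta] eventually, for every [beta < alpha];
    the Chernoff bound gives [m(Y_n) > a] eventually, for every [a < mu].
    Sparsity follows by choosing [beta a > 1]. *)

(** * The gamma function *)

Section gamma.
Context {R : realType}.
Implicit Types (a b x y s t u : R).
Local Notation leb := (@lebesgue_measure R).

Definition gamma_integrand x t : R := t `^ (x - 1) * expR (- t).

Definition gamma_integral x : \bar R :=
  (\int[leb]_(t in `]0%R, +oo[) (gamma_integrand x t)%:E)%E.

Lemma gamma_integrand_ge0 x t : 0 <= gamma_integrand x t.
Proof. by rewrite mulr_ge0 ?powR_ge0 ?expR_ge0. Qed.

Lemma measurable_gamma_integrand x (D : set R) :
  measurable_fun D (fun t : R => (gamma_integrand x t)%:E).
Proof.
apply: (measurable_funS measurableT) => //.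
apply/measurable_EFinP; apply: measurable_funM; first exact: measurable_powR.
by apply: measurableT_comp => //; exact: measurable_expR.
Qed.

(** Raise [y / (x + 1) <= expR (y / (x + 1))] to the power [x + 1]. The spare factor [1 / y] makes
    the boundary term of the integration by parts vanish at infinity. *)
Lemma powR_expRN_le x y : 0 < x -> 0 < y ->
  y `^ x * expR (- y) <= (x + 1) `^ (x + 1) / y.
Proof.
move=> x0 y0; have k0 : 0 < x + 1 by lra.
have H : (y / (x + 1)) `^ (x + 1) <= expR y.
  rewrite -{2}(@divfK _ (x + 1) _ y) ?gt_eqF// expRM.
  apply: ge0_ler_powR; rewrite ?nnegrE ?expR_ge0 ?divr_ge0 ?ltW//.
  by have := expR_ge1Dx (y / (x + 1)); lra.
rewrite expRN ler_pdivrMr ?expR_gt0// mulrAC ler_pdivlMr//.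
rewrite -[X in _ * X <= _](powRr1 (ltW y0)) -powRD; last by rewrite gt_eqF.
rewrite -{1}(@divfK _ (x + 1) _ y) ?gt_eqF// powRM ?divr_ge0 ?(ltW k0) ?(ltW y0)// mulrC.
by rewrite ler_pM2l// powR_gt0.
Qed.

Lemma is_derive_opp_expRN t : is_derive t 1 (fun u => - expR (- u)) (expR (- t)).
Proof. by apply: is_derive_eq; rewrite mulrN1 opprK. Qed.

(** The interval stays away from 0, where [powR] need not be differentiable; 0 and infinity are
    reached afterwards by a limit. *)
Lemma gamma_by_parts x a b : 0 < x -> 0 < a -> a < b ->
  (\int[leb]_(t in `[a, b]) (gamma_integrand (x + 1) t)%:E =
   (a `^ x * expR (- a) - b `^ x * expR (- b))%:E +
   \int[leb]_(t in `[a, b]) (x * gamma_integrand x t)%:E)%E.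
Proof.
move=> x0 a0 ab.
have pos t : t \in `[a, b] -> 0 < t.
  by rewrite in_itv/= => /andP[+ _]; exact: lt_le_trans.
have poso t : t \in `]a, b[ -> 0 < t.
  by rewrite in_itv/= => /andP[+ _]; exact: lt_trans.
have cpow r t : 0 < t -> {for t, continuous (@powR R ^~ r)}.
  move=> t0; apply/differentiable_continuous/derivable1_diffP.
  by apply: derivable_powR; rewrite in_itv/= andbT.
have cexp : continuous (fun t => expR (- t) : R).
  move=> t; apply: continuous_comp; last exact: continuous_expR.
  exact: continuousN.
have := @integration_by_parts R (@powR R ^~ x) (fun t => - expR (- t))
  (fun t => x * t `^ (x - 1)) (fun t => expR (- t)) a b ab.
rewrite /gamma_integrand addrK => ->.
- congr (_ + _)%E; first by rewrite !mulrN opprK addrC.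
  under eq_integral do rewrite mulrN EFinN -mulrA.
  rewrite integral_ge0N ?oppeK// => t _.
  by rewrite lee_fin !mulr_ge0 ?powR_ge0 ?expR_ge0 ?ltW.
- apply: continuous_in_subspaceT => t /set_mem/= tab.
  by apply: cvgM; [exact: cvg_cst|exact: (cpow _ _ (pos _ tab))].
- split; first by move=> t tab; apply: derivable_powR; rewrite in_itv/= andbT (poso _ tab).
  + by apply/cvg_at_right_filter; apply: cpow.
  + by apply/cvg_at_left_filter; apply: cpow; exact: lt_trans ab.
- by move=> t tab; apply: powR_derive1; rewrite in_itv/= andbT poso.
- exact: continuous_subspaceT.
- split; first by move=> t tab; exact: ex_derive.
  + by apply/cvg_at_right_filter; apply: cvgN; exact: cexp.
  + by apply/cvg_at_left_filter; apply: cvgN; exact: cexp.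
- by move=> t tab; rewrite derive1E; apply: derive_val; exact: is_derive_opp_expRN.
Qed.

(** The right end is [n.+2] and not [n.+1], so that the interval is nondegenerate already at
    [n = 0]. *)
Lemma bigcup_itv_inv_natr :
  \bigcup_n `[(n.+1%:R^-1 : R), n.+2%:R]%classic = `]0, +oo[%classic :> set R.
Proof.
apply/seteqP; split=> t /=.
  by move=> [n _] /=; rewrite !in_itv/= andbT => /andP[+ _]; apply: lt_le_trans.
rewrite in_itv/= andbT => t0.
exists (maxn (Num.truncn t) (Num.truncn t^-1)) => //=; rewrite in_itv/=; apply/andP; split.
  rewrite -[leRHS]invrK lef_pV2 ?posrE ?invr_gt0//.
  apply: ltW; apply: (lt_le_trans (truncnS_gt _)).
  by rewrite ler_nat ltnS leq_maxr.
apply: ltW; apply: (lt_le_trans (truncnS_gt _)).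
by rewrite ler_nat ltnS leqW// leq_maxl.
Qed.

Lemma gamma_integral_cvg x :
  ((\int[leb]_(t in `[(n.+1%:R^-1)%R, n.+2%:R]) (gamma_integrand x t)%:E)%E
    @[n --> \oo] --> gamma_integral x).
Proof.
rewrite /gamma_integral -bigcup_itv_inv_natr.
apply: ge0_nondecreasing_set_cvg_integral => //.
- apply/nondecreasing_seqP => n; rewrite subsetEset; apply: subset_itv.
  + by rewrite bnd_simp lef_pV2 ?posrE// ler_nat.
  + by rewrite bnd_simp ler_nat.
- by move=> n; exact: measurable_gamma_integrand.
- by move=> n t _; rewrite lee_fin gamma_integrand_ge0.
Qed.

Lemma gamma_boundary_cvg0 x : 0 < x ->
  (n.+1%:R^-1 `^ x * expR (- n.+1%:R^-1) - n.+2%:R `^ x * expR (- n.+2%:R) : R)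
    @[n --> \oo] --> 0.
Proof.
move=> x0; rewrite -[X in _ --> X](subr0 0); apply: cvgB.
- apply: (@squeeze_cvgr _ _ _ _ (cst 0) (fun n : nat => n.+1%:R^-1 `^ x)).
  + apply: nearW => n; rewrite mulr_ge0 ?powR_ge0 ?expR_ge0//=.
    rewrite ler_piMr ?powR_ge0// -expR0 ler_expR oppr_le0 invr_ge0//.
  + exact: cvg_cst.
  + have /cvg_at_rightP := @powR_cvg0 R x x0; apply; split; first by move=> n; rewrite invr_gt0.
    exact: cvg_harmonic.
- apply: (@squeeze_cvgr _ _ _ _ (cst 0)
    (fun n : nat => (x + 1) `^ (x + 1) * n.+1%:R^-1)).
  + apply: nearW => n; rewrite mulr_ge0 ?powR_ge0 ?expR_ge0//=.
    apply: (le_trans (@powR_expRN_le x _ x0 _)) => //.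
    by rewrite ler_wpM2l ?powR_ge0// lef_pV2 ?posrE// ler_nat.
  + exact: cvg_cst.
  + rewrite -[X in _ --> X](mulr0 ((x + 1) `^ (x + 1))).
    by apply: cvgM; [exact: cvg_cst|exact: cvg_harmonic].
Qed.

Lemma gamma_integralD1 x : 0 < x ->
  gamma_integral (x + 1) = (x%:E * gamma_integral x)%E.
Proof.
move=> x0; have A := @gamma_integral_cvg (x + 1).
suff B : (\int[leb]_(t in `[(n.+1%:R^-1)%R, n.+2%:R]) (gamma_integrand (x + 1) t)%:E)%E
    @[n --> \oo] --> (0 + x%:E * gamma_integral x)%E.
  by rewrite add0e in B; exact: (cvg_unique _ A B).
have ab n : n.+1%:R^-1 < n.+2%:R :> R.
  by apply: (@le_lt_trans _ _ 1); rewrite ?invf_le1// ?ltr1n// ler1n.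
under eq_cvg => n.
  rewrite gamma_by_parts// ?invr_gt0//.
  under eq_integral do rewrite EFinM.
  rewrite ge0_integralZl//; last 3 first.
  - exact: measurable_gamma_integrand.
  - by move=> t _; rewrite lee_fin gamma_integrand_ge0.
  - by rewrite lee_fin ltW.
  over.
apply: cvgeD; first by rewrite fin_num_adde_defr.
- by apply: cvg_EFin; [exact: nearW|exact: gamma_boundary_cvg0].
- by apply: cvgeZl => //; exact: gamma_integral_cvg.
Qed.

Lemma gamma_integral1 : gamma_integral 1 = 1%E.
Proof.
rewrite /gamma_integral integral_itv_obnd_cbnd; last exact: measurable_gamma_integrand.
have E t : gamma_integrand 1 t = expR (- t).
  by rewrite /gamma_integrand subrr powRr0 mul1r.
under eq_integral do rewrite E.
rewrite (@ge0_continuous_FTC2y _ _ (fun t => - expR (- t)) _ 0)//.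
- by rewrite oppr0 expR0 EFinN oppeK add0e.
- apply: continuous_subspaceT => t; apply: continuous_comp; last exact: continuous_expR.
  exact: continuousN.
- by rewrite -oppr0; apply: cvgN; exact: cvgr_expR.
- by apply: cvg_at_right_filter; apply: cvgN; apply: continuous_comp; [exact: continuousN|exact: continuous_expR].
- by move=> t _; rewrite derive1E; apply: derive_val; exact: is_derive_opp_expRN.
Qed.

Lemma powR_le_tangent c s u : 0 < c -> 0 <= s <= 1 -> 0 <= u ->
  u `^ s <= c `^ s * (1 - s + s * (u / c)).
Proof.
move=> c0 /andP[s0 s1] u0.
have v0 : 0 <= u / c by rewrite divr_ge0// ltW.
rewrite -{1}(divfK (lt0r_neq0 c0) u) powRM ?(ltW c0)// mulrC.
rewrite ler_pM2l ?powR_gt0//; move: (u / c) v0 => v v0.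
have [->|sn0] := eqVneq s 0; first by rewrite powRr0; lra.
have [->|sn1] := eqVneq s 1; first by rewrite powRr1//; lra.
have s0' : 0 < s by rewrite lt_neqAle eq_sym sn0.
have s1' : 0 < 1 - s by rewrite subr_gt0 lt_neqAle sn1.
have := @conjugate_powR R (v `^ s) 1 s^-1 (1 - s)^-1 (powR_ge0 _ _) ler01.
rewrite !invr_gt0 !invrK => /(_ s0' s1').
by rewrite -powRrM divff// powRr1// powR1 mulr1 mul1r; lra.
Qed.

Lemma gamma_integral_ge0 x : (0 <= gamma_integral x)%E.
Proof. by apply: integral_ge0 => t _; rewrite lee_fin gamma_integrand_ge0. Qed.

Lemma gamma_integral_lty x : 0 < x -> (gamma_integral x < +oo)%E.
Proof.
have low y : 1 <= y <= 2 -> (gamma_integral y < +oo)%E.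
  move=> /andP[y1 y2].
  have g2 : gamma_integral 2 = 1%E.
    by rewrite [2](_ : _ = 1 + 1)// gamma_integralD1// gamma_integral1 mule1.
  apply: (@le_lt_trans _ _ (gamma_integral 1 + gamma_integral 2)%E); last first.
    by rewrite gamma_integral1 g2 -EFinD ltry.
  rewrite /gamma_integral -ge0_integralD//=; last 4 first.
  - by move=> t _; rewrite lee_fin gamma_integrand_ge0.
  - exact: measurable_gamma_integrand.
  - by move=> t _; rewrite lee_fin gamma_integrand_ge0.
  - exact: measurable_gamma_integrand.
  apply: ge0_le_integral => //=.
  - by move=> t _; rewrite lee_fin gamma_integrand_ge0.
  - exact: measurable_gamma_integrand.
  - by apply: emeasurable_funD; exact: measurable_gamma_integrand.
  move=> t; rewrite in_itv/= andbT => t0.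
  rewrite -EFinD lee_fin /gamma_integrand -mulrDl ler_wpM2r ?expR_ge0//.
  rewrite subrr powRr0 [2 - 1](_ : _ = 1); last by ring.
  rewrite powRr1 ?(ltW t0)//; have := @powR_le_tangent 1 (y - 1) t ltr01.
  rewrite powR1 mul1r divr1 => /(_ _ (ltW t0)); rewrite subr_ge0 y1/=.
  have -> : y - 1 <= 1 by lra.
  by move=> /(_ isT) /le_trans; apply; nra.
have up n : forall y, 0 < y <= n.+2%:R -> (gamma_integral y < +oo)%E.
  elim: n => [|n IH] y /andP[y0 yn].
    have [y1|y1] := leP 1 y; first by apply: low; rewrite y1.
    have : (gamma_integral (y + 1) < +oo)%E by apply: low; lra.
    rewrite gamma_integralD1//; case: (gamma_integral y) (gamma_integral_ge0 y) => [r _ _|_|//]; first exact: ltry.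
    by rewrite gt0_muley// lte_fin.
  have [y1|y1] := leP y 2; first by apply: (IH y); rewrite y0 (le_trans y1)// ler_nat.
  rewrite -(subrK 1 y) gamma_integralD1; last by lra.
  have : (gamma_integral (y - 1) < +oo)%E.
    apply: IH; apply/andP; split; first by lra.
    by rewrite lerBlDr natr1.
  by case: (gamma_integral (y - 1)) (gamma_integral_ge0 (y - 1)) => // r _ _; exact: ltry.
move=> x0; apply: (up (Num.truncn x)); rewrite x0/=.
by apply: ltW; apply: (lt_le_trans (truncnS_gt _)); rewrite ler_nat.
Qed.

(** [Gamma] is a [fine], which would turn an infinite integral into 0; finiteness excludes this. *)
Lemma GammaK x : 0 < x -> (Gamma x)%:E = gamma_integral x.
Proof.
move=> x0; rewrite /Gamma -/(gamma_integral x) fineK// ge0_fin_numE ?gamma_integral_ge0//.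
exact: gamma_integral_lty.
Qed.

Lemma Gamma_ge0 x : 0 <= Gamma x.
Proof. exact/fine_ge0/gamma_integral_ge0. Qed.

Lemma GammaD1 x : 0 < x -> Gamma (x + 1) = x * Gamma x.
Proof.
move=> x0; apply: EFin_inj; rewrite EFinM !GammaK ?gamma_integralD1//; lra.
Qed.

Lemma Gamma1 : Gamma 1 = 1 :> R.
Proof. by apply: EFin_inj; rewrite GammaK// gamma_integral1. Qed.

(* Integrate [t `^ s <= y `^ s * (1 - s + s * (t / y))] against the integrand of [Gamma y]. *)
Lemma Gamma_le_powR y s : 0 < y -> 0 <= s <= 1 ->
  Gamma (y + s) <= y `^ s * Gamma y.
Proof.
move=> y0 s01; have /andP[s0 s1] := s01; have ys0 : 0 < y + s by lra.
pose A := y `^ s * (1 - s); pose B := y `^ s * (s / y).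
have A0 : 0 <= A by rewrite mulr_ge0 ?powR_ge0// subr_ge0.
have B0 : 0 <= B by rewrite mulr_ge0 ?powR_ge0// divr_ge0// ltW.
have : (gamma_integral (y + s) <= A%:E * gamma_integral y + B%:E * gamma_integral (y + 1))%E.
  rewrite /gamma_integral -!ge0_integralZl//=; last 4 first.
  - exact: measurable_gamma_integrand.
  - by move=> t _; rewrite lee_fin gamma_integrand_ge0.
  - exact: measurable_gamma_integrand.
  - by move=> t _; rewrite lee_fin gamma_integrand_ge0.
  rewrite -ge0_integralD//=; last 4 first.
  - by move=> t _; rewrite lee_fin mulr_ge0// gamma_integrand_ge0.
  - by apply: measurable_funeM; exact: measurable_gamma_integrand.
  - by move=> t _; rewrite lee_fin mulr_ge0// gamma_integrand_ge0.
  - by apply: measurable_funeM; exact: measurable_gamma_integrand.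
  apply: ge0_le_integral => //=.
  - by move=> t _; rewrite lee_fin gamma_integrand_ge0.
  - exact: measurable_gamma_integrand.
  - by apply: emeasurable_funD; apply: measurable_funeM; exact: measurable_gamma_integrand.
  move=> t; rewrite in_itv/= andbT => t0.
  rewrite lee_fin /gamma_integrand addrK addrAC [t `^ (y - 1 + s)]powRD ?(gt_eqF t0) ?implybT//.
  rewrite -[in X in B * (X * _)](@mulr_powRB1 _ t y) ?(ltW t0)//.
  rewrite mulrA mulrA mulrA -mulrDl ler_wpM2r ?expR_ge0//.
  have := @powR_le_tangent y s t y0 s01 (ltW t0).
  move=> /(ler_wpM2l (powR_ge0 t (y - 1))) /le_trans; apply.
  by rewrite le_eqVlt; apply/orP; left; apply/eqP; rewrite /A /B; ring.
rewrite -!GammaK//; last by lra.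
rewrite -!EFinM -EFinD lee_fin => /le_trans; apply.
rewrite GammaD1// /A /B; rewrite le_eqVlt; apply/orP; left; apply/eqP; field.
by rewrite gt_eqF.
Qed.

Lemma Gamma_gt0 x : 0 < x -> 0 < Gamma x.
Proof.
have low y : 1 <= y <= 2 -> 0 < Gamma y.
  move=> /andP[y1 y2].
  have := @Gamma_le_powR y (2 - y) ltac:(lra) ltac:(lra).
  rewrite addrC subrK [X in Gamma X](_ : _ = 1 + 1)// GammaD1// Gamma1 mulr1 => H.
  rewrite lt_neqAle Gamma_ge0 andbT; apply/eqP => H0.
  by move: H; rewrite -H0 mulr0 ler10.
have up n : forall y, 0 < y <= n.+2%:R -> 0 < Gamma y.
  elim: n => [|n IH] y /andP[y0 yn].
    have [y1|y1] := leP 1 y; first by apply: low; rewrite y1.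
    have : 0 < Gamma (y + 1) by apply: low; lra.
    by rewrite GammaD1// pmulr_rgt0.
  have [y1|y1] := leP y 2; first by apply: (IH y); rewrite y0 (le_trans y1)// ler_nat.
  rewrite -(subrK 1 y) GammaD1; last by lra.
  rewrite mulr_gt0//; first by lra.
  apply: IH; apply/andP; split; first by lra.
  by rewrite lerBlDr natr1.
move=> x0; apply: (up (Num.truncn x)); rewrite x0/=.
by apply: ltW; apply: (lt_le_trans (truncnS_gt _)); rewrite ler_nat.
Qed.

(** The other half of Wendel's inequalities: apply the upper bound at [y + s] with exponent [1 - s],
    which lands on [Gamma (y + 1) = y * Gamma y]. *)
Lemma Gamma_ge_powR y s : 0 < y -> 0 <= s <= 1 ->
  y * Gamma y / (y + s) `^ (1 - s) <= Gamma (y + s).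
Proof.
move=> y0 s01; have /andP[s0 s1] := s01.
have ys0 : 0 < y + s by lra.
rewrite ler_pdivrMr ?powR_gt0// -GammaD1// [in leRHS]mulrC.
by have := @Gamma_le_powR (y + s) (1 - s) ys0 ltac:(lra); rewrite addrA [y + s + 1 - s](_ : _ = y + 1); last by ring.
Qed.

End gamma.

(** * Sums over sequences, histories and harmonic weights *)

Section esum_extra.
Context {R : realType}.
Local Open Scope ereal_scope.

Lemma esumZl (T : choiceType) (I : set T) (c : \bar R) (a : T -> \bar R) :
  0 <= c -> (forall i, 0 <= a i) ->
  \esum_(i in I) (c * a i) = c * \esum_(i in I) a i.
Proof.
have real_le (r : R) (b : T -> \bar R) : (0 < r)%R -> (forall i, 0 <= b i) ->
    \esum_(i in I) (r%:E * b i) <= r%:E * \esum_(i in I) b i.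
  move=> r0 b0; apply: ge_ereal_sup => _ [X [finX XI] <-].
  rewrite -ge0_mule_fsumr// lee_pmul2l ?lte_fin//.
  by apply: ereal_sup_ubound; exists X.
case: c => [r| |//] c0 a0.
- rewrite lee_fin le_eqVlt in c0; case/orP: c0 => [/eqP <-|r0].
    by rewrite mul0e esum1// => i _; rewrite mul0e.
  (* The converse inequality is [real_le] for the factor [r^-1] and the family [r * a]. *)
  apply/eqP; rewrite eq_le real_le//=.
  rewrite -[leRHS]mul1e -(@divff _ r) ?gt_eqF// EFinM -muleA.
  rewrite lee_pmul2l ?lte_fin//.
  have ra0 i : 0 <= r%:E * a i by rewrite mule_ge0// lee_fin ltW.
  have rV0 : (0 < r^-1)%R by rewrite invr_gt0.
  apply: le_trans (real_le r^-1%R (fun i => r%:E * a i) rV0 ra0).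
  by apply: le_esum => i _; rewrite muleA -EFinM mulVf ?gt_eqF// mul1e.
- have [[i Ii ai]|H] := pselect (exists2 i, I i & a i != 0).
    have ai0 : 0 < a i by rewrite lt_neqAle eq_sym ai a0.
    have pos (b : T -> \bar R) : b i <= \esum_(i in I) b i.
      apply: esum_ge; exists [set i]; last by rewrite fsbig_set1.
      by split=> //= _ ->.
    rewrite gt0_mulye; last exact: lt_le_trans (pos a).
    by apply/eqP; rewrite -leye_eq; apply: le_trans (pos _); rewrite gt0_mulye.
  have z i : I i -> a i = 0.
    by move=> Ii; apply: contrapT => /eqP ai; apply: H; exists i.
  by rewrite !esum1 ?mule0// => i /z ->; rewrite ?mule0.
Qed.

Lemma esum_seq (T : choiceType) (r : seq T) (a : T -> \bar R) :
  uniq r -> (forall i, 0 <= a i) -> (forall i, i \notin r -> a i = 0) ->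
  \esum_(i in [set: T]) a i = \sum_(i <- r) a i.
Proof.
move=> ur a0 az; rewrite fsbig_seq//= -esum_fset//.
  rewrite [RHS]esum_mkcond; apply: eq_esum => i _.
  by case: ifPn => //; rewrite notin_setE/= => /negP /az.
Qed.

Lemma esum_size_cons (T : choiceType) k (a : seq T -> \bar R) :
  (forall s, size s = k.+1 -> 0 <= a s) ->
  \esum_(s in [set s | size s = k.+1]) a s =
  \esum_(x in [set: T]) \esum_(s in [set s | size s = k]) a (x :: s).
Proof.
move=> a0; rewrite esum_esum; last by move=> x s _ /= sk; rewrite a0//= sk.
apply: reindex_esum; split.
- by move=> [x s] [_ /= sk] /=; rewrite sk.
- by move=> [x s] [y u] _ _ /= [-> ->].
- by move=> [//|x s] /= [sk]; exists (x, s).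
Qed.

Lemma esum_size0 (T : choiceType) (a : seq T -> \bar R) : 0 <= a [::] ->
  \esum_(s in [set s | size s = 0%N]) a s = a [::].
Proof.
move=> a0; rewrite -[RHS](@esum_set1 _ _ _ a)//; congr (esum _ _).
by apply/seteqP; split => [[]//|s ->].
Qed.

Lemma esum_by_size (T : choiceType) (a : seq T -> \bar R) :
  (forall s, 0 <= a s) ->
  \esum_(s in [set: seq T]) a s =
  \esum_(k in [set: nat]) \esum_(s in [set s | size s = k]) a s.
Proof.
move=> a0; rewrite -(@esum_bigcupT _ _ setT (fun k => [set s | size s = k]))//.
  by congr (esum _ _); apply/seteqP; split => // s _; exists (size s).
by move=> i j _ _ [s [/= <- <-]].
Qed.

End esum_extra.

(** * Integration of functions of a countably valued variable *)

Section discrete_integral.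
Context {R : realType} {d : measure_display} {T : measurableType d}.
Context {C : countType} (P : {measure set T -> \bar R}) (g : T -> C).
Hypothesis mg : forall c, measurable [set t | g t = c].

Lemma measurable_preimage_countType (A : set C) : measurable (g @^-1` A).
Proof.
rewrite (_ : g @^-1` A = \bigcup_(c in A) [set t | g t = c]); last first.
  by apply/seteqP; split => [t At|t [c Ac /= ->]//]; exists (g t).
rewrite bigcup_mkcond; apply: countable_bigcupT_measurable => [|c].
  exact: countableP.
by case: ifP.
Qed.

Lemma measurable_fun_countType d' (U : measurableType d') (F : C -> U) :
  measurable_fun [set: T] (fun t => F (g t)).
Proof.
by move=> _ B _; rewrite setTI; exact: (measurable_preimage_countType (F @^-1` B)).
Qed.

Lemma ge0_integral_countType (F : C -> \bar R) : (forall c, 0 <= F c)%E ->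
  (\int[P]_t F (g t) = \esum_(c in [set: C]) F c * P [set t | g t = c])%E.
Proof.
move=> F0.
(* The fibres of [g] partition the space; they are enumerated by codes, and a number coding no value
   receives the empty set. *)
pose A i := if pickle_inv i is Some c then [set t | g t = c] else set0.
have UA : \bigcup_i A i = [set: T].
  by apply/seteqP; split => // t _; exists (pickle (g t)) => //; rewrite /A pickleK_inv.
rewrite -UA ge0_integral_bigcup//; last 3 first.
- by move=> i; rewrite /A; case: pickle_inv.
- by rewrite UA; exact: measurable_fun_countType.
- move=> i j _ _ [t []]; rewrite /A.
  case Ei : (pickle_inv i) => [c|//] /= gc; case Ej : (pickle_inv j) => [c'|//] /= gc'.
  by rewrite -(@pickle_invK C i) -(@pickle_invK C j) Ei Ej/= -gc gc'.
rewrite nneseries_esumT; last by move=> i; exact: integral_ge0.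
pose b i := if pickle_inv i is Some c then (F c * P [set t | g t = c])%E else 0%E.
rewrite (eq_esum (b := b)); last first.
  move=> i _; rewrite /A /b; case: pickle_inv => [c|]; last by rewrite integral_set0.
  rewrite -(integral_cst P (mg c) (F c)); apply: eq_integral => t /set_mem /= ->//.
transitivity (\esum_(i in pickle @` [set: C]) b i).
  rewrite [RHS]esum_mkcond; apply: eq_esum => i _; case: ifPn => //.
  rewrite notin_setE /b /= => H; case E: pickle_inv => [c|//]; exfalso; apply: H.
  by exists c => //; have := @pickle_invK C i; rewrite E.
rewrite esum_image; last by move=> x y _ _; exact: (pcan_inj pickleK_inv).
by apply: eq_esum => c _; rewrite /b pickleK_inv.
Qed.

End discrete_integral.

(** * Label histories *)

Section histories.
Local Open Scope nat_scope.
Implicit Types (h : seq nat) (x : nat).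

Definition ndist h := size (undup h).

(** What the draws need of the rule that labels are numbered in order of first appearance: the
    labels present form an initial segment of the positive integers. *)
Definition valid_history h := forall x, (x \in h) = (1 <= x <= ndist h).

Lemma ndist_rcons h x : ndist (rcons h x) = ndist h + (x \notin h).
Proof.
rewrite /ndist (perm_size (perm_undup (_ : rcons h x =i x :: h))).
  by rewrite /=; case: ifP => /=; rewrite ?addn0 ?addn1.
by move=> y; rewrite mem_rcons.
Qed.

Lemma valid_nil : valid_history [::].
Proof. by move=> x; rewrite /ndist/= in_nil; lia. Qed.

Lemma valid_rcons h x : valid_history h -> 1 <= x <= (ndist h).+1 ->
  valid_history (rcons h x).
Proof.
move=> vh xV y; rewrite mem_rcons inE ndist_rcons (vh x) (vh y).
by case: eqVneq => [->|xy]/=; lia.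
Qed.

Lemma ndist_gt0 h : (0 < ndist h) = (h != [::]).
Proof.
case: h => [//|x h]; rewrite /ndist -has_predT; apply/hasP.
by exists x => //; rewrite mem_undup mem_head.
Qed.

Lemma sum_count_mem_uniq (r h : seq nat) : uniq r ->
  \sum_(x <- r) count_mem x h = count (mem r) h.
Proof.
move=> ur; elim: h => [|y h IH] /=; first by rewrite big1.
rewrite big_split/= IH; congr (_ + _); case: (boolP (y \in r)) => yr.
  rewrite (bigD1_seq y)//= eqxx big1 ?addn0// => x; rewrite eq_sym => /negbTE->//.
by rewrite big_seq big1// => x xr; case: eqVneq yr => // ->; rewrite xr.
Qed.

Lemma sum_count_valid h : valid_history h ->
  \sum_(1 <= x < (ndist h).+1) count_mem x h = size h.
Proof.
move=> vh; rewrite sum_count_mem_uniq ?iota_uniq//.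
apply/eqP; rewrite -all_count; apply/allP => x xh.
by rewrite inE mem_index_iota ltnS -vh.
Qed.

End histories.

Section draws.
Context {R : realType} (alpha theta : R).
Hypotheses (a0 : 0 < alpha) (a1 : alpha < 1) (ta : - alpha < theta).
Implicit Types (h e : seq nat) (x : nat).

Lemma draw_prob_nz h x : draw_prob alpha theta h x != 0 ->
  (1 <= x <= (ndist h).+1)%N.
Proof.
rewrite /draw_prob -/(ndist h); case: ifP => _.
  by have [->//|_] := eqVneq x 1%N; rewrite eqxx.
case: ifP => [/andP[-> /leqW ->]//|_].
by have [->|_] := eqVneq x (ndist h).+1; rewrite ?leqnn// eqxx.
Qed.

Lemma size_theta_gt0 h : h != [::] -> 0 < (size h)%:R + theta.
Proof.
case: h => // x h _ /=.
have : 1 <= (size h).+1%:R :> R by rewrite ler1n.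
by move: a1 ta; lra.
Qed.

Lemma draw_prob_ge0 h x : valid_history h -> 0 <= draw_prob alpha theta h x.
Proof.
move=> vh; rewrite /draw_prob -/(ndist h); case: ifPn => // hn0.
have h0 : h != [::] by rewrite -size_eq0.
have st := ltW (size_theta_gt0 h0).
case: ifP => [xV|_].
  apply: divr_ge0 => //; rewrite subr_ge0 (le_trans (ltW a1))//.
  by rewrite ler1n -has_count has_pred1 vh.
case: ifP => // _; apply: divr_ge0 => //.
have : 1 <= (ndist h)%:R :> R by rewrite ler1n ndist_gt0.
by move: a0 ta; nra.
Qed.

(** The two claims go together: a later draw has nonnegative probability because the history it
    extends is valid, and that history is valid as soon as the earlier draws have nonzero
    probability. *)
Lemma seq_prob_valid h e : valid_history h ->
  0 <= seq_prob alpha theta h e /\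
  (seq_prob alpha theta h e != 0 -> valid_history (h ++ e)).
Proof.
elim: e h => [|x e IH] h vh /=; first by rewrite cats0.
have [->|dn0] := eqVneq (draw_prob alpha theta h x) 0.
  by rewrite mul0r eqxx.
have [s0 sv] := IH _ (valid_rcons vh (draw_prob_nz dn0)).
split; first by rewrite mulr_ge0// draw_prob_ge0.
by rewrite mulf_eq0 negb_or => /andP[_ /sv]; rewrite cat_rcons.
Qed.

Lemma seq_prob_ge0 h e : valid_history h -> 0 <= seq_prob alpha theta h e.
Proof. by move=> /(seq_prob_valid e)[]. Qed.

End draws.

(** * Weights that are harmonic for the label draws *)

Section harmonic.
Context {R : realType} (alpha theta q : R) (w W : nat -> R).
Hypotheses (a0 : 0 < alpha) (a1 : alpha < 1) (ta : - alpha < theta).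
Hypotheses (w_ge0 : forall v, 0 <= w v) (W_gt0 : forall m, 0 < W m).
Hypotheses (w0 : w 0%N = w 1%N) (W0 : W 0%N = W 1%N).
Hypothesis wS : forall v, (0 < v)%N ->
  (theta + alpha * v%:R) * w v.+1 = (theta + alpha * v%:R + q) * w v.
Hypothesis WS : forall m, (0 < m)%N ->
  (m%:R + theta) * W m.+1 = (m%:R + theta + q) * W m.
Implicit Types (h e : seq nat).

Definition hweight h : R := w (ndist h) / W (size h).

Lemma hweight_ge0 h : 0 <= hweight h.
Proof. by rewrite divr_ge0// ltW. Qed.

(** With [V] labels after [N] draws, the old labels have total mass [(N - alpha V) / (N + theta)]
    and keep [w V], while the new label has mass [(theta + alpha V) / (N + theta)] and gives
    [w V.+1]. By [wS] the numerators add up to [(N + theta + q) * w V], and [WS] cancels this factor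
    against [W N.+1]. From the empty history the first label is surely new, and [w0], [W0] keep the
    weight unchanged. *)
Lemma hweight_harmonic h : valid_history h ->
  \sum_(1 <= x < (ndist h).+2) draw_prob alpha theta h x * hweight (rcons h x)
  = hweight h.
Proof.
move=> vh; have [->|h0] := eqVneq h [::].
  rewrite big_nat1 /draw_prob/= mul1r /hweight/ndist/= w0 W0//.
have V0 : (0 < ndist h)%N by rewrite ndist_gt0.
have N0 : (0 < size h)%N by rewrite lt0n size_eq0.
have st := size_theta_gt0 a1 ta h0.
rewrite big_nat_recr//= {2}/draw_prob -/(ndist h) size_eq0 (negbTE h0).
rewrite ltnn andbF eqxx /hweight ndist_rcons vh ltnn andbF addn1 size_rcons.
rewrite (eq_big_nat _ _ (F2 := fun x =>
  ((count_mem x h)%:R - alpha) * (w (ndist h) / W (size h).+1 / ((size h)%:R + theta)))); last first.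
  move=> x; rewrite ltnS => xV; rewrite /draw_prob -/(ndist h) size_eq0 (negbTE h0) xV.
  by rewrite ndist_rcons vh xV addn0 size_rcons; ring.
rewrite -mulr_suml sumrB -natr_sum sum_count_valid// sumr_const_nat subn1/=.
have WS' := WS N0; have wS' := wS V0.
have WN := lt0r_neq0 (W_gt0 (size h)); have WN1 := lt0r_neq0 (W_gt0 (size h).+1).
have sn := lt0r_neq0 st.
apply: (mulfI (mulf_neq0 sn (mulf_neq0 WN WN1))).
transitivity ((((size h)%:R - alpha *+ ndist h) * w (ndist h) +
   (theta + alpha * (ndist h)%:R) * w (ndist h).+1) * W (size h)).
  by field; rewrite sn WN1.
rewrite wS' -[alpha *+ _]mulr_natr.
transitivity (((size h)%:R + theta + q) * W (size h) * w (ndist h)); first by ring.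
by rewrite -WS'; field.
Qed.

Local Open Scope ereal_scope.

Lemma esum_draw_hweight h : valid_history h ->
  \esum_(x in [set: nat]) (draw_prob alpha theta h x * hweight (rcons h x))%:E
  = (hweight h)%:E.
Proof.
move=> vh; rewrite (@esum_seq _ _ (index_iota 1 (ndist h).+2)) ?iota_uniq//.
- by rewrite sumEFin hweight_harmonic.
- by move=> x; rewrite lee_fin mulr_ge0 ?hweight_ge0// draw_prob_ge0.
move=> x; rewrite mem_index_iota ltnS => xV.
have [->|/draw_prob_nz H] := eqVneq (draw_prob alpha theta h x) 0%R; first by rewrite mul0r.
by rewrite H in xV.
Qed.

Lemma esum_seq_hweight k h : valid_history h ->
  \esum_(e in [set e | size e = k]) (seq_prob alpha theta h e * hweight (h ++ e))%:E
  = (hweight h)%:E.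
Proof.
have g0 h' e : valid_history h' -> 0 <= (seq_prob alpha theta h' e * hweight (h' ++ e))%:E.
  by move=> vh; rewrite lee_fin mulr_ge0 ?hweight_ge0// seq_prob_ge0.
elim: k h => [|k IH] h vh.
  by rewrite esum_size0 ?g0//= mul1r cats0.
rewrite esum_size_cons; last by move=> *; exact: g0.
rewrite -esum_draw_hweight//; apply: eq_esum => x _ /=.
have [->|dn0] := eqVneq (draw_prob alpha theta h x) 0%R.
  by rewrite mul0r esum1// => e _; rewrite !mul0r.
have vx := valid_rcons vh (draw_prob_nz dn0).
rewrite EFinM -IH// -esumZl//.
- by apply: eq_esum => e _; rewrite -cat_rcons -mulrA EFinM.
- by rewrite lee_fin draw_prob_ge0.
- by move=> e; exact: g0.
Qed.

End harmonic.

(** * Random walk with step law nu *)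

Section walk.
Context {R : realType} (nu : nat -> R).
Hypothesis nu_ge0 : forall k, 0 <= nu k.
Local Open Scope ereal_scope.
Implicit Types (psi phi : nat -> \bar R) (m n k : nat).

(* The expectation of [psi (m + K_1 + ... + K_n)] for i.i.d. [K_i] of law [nu]. *)
Fixpoint walk_exp n psi m : \bar R :=
  if n is n'.+1 then
    \esum_(k in [set: nat]) ((nu k)%:E * walk_exp n' psi (m + k)%N)
  else psi m.

Lemma walk_exp_ge0 n psi m : (forall i, 0 <= psi i) -> 0 <= walk_exp n psi m.
Proof.
move=> psi0; elim: n m => [//|n IH] m /=.
by apply: esum_ge0 => k _; rewrite mule_ge0// lee_fin.
Qed.

Lemma le_walk_exp n psi phi m : (forall i, psi i <= phi i) ->
  walk_exp n psi m <= walk_exp n phi m.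
Proof.
move=> le_pp; elim: n m => [//|n IH] m /=.
by apply: le_esum => k _; rewrite lee_wpmul2l// lee_fin.
Qed.

Lemma walk_expD n psi phi m :
  (forall i, 0 <= psi i) -> (forall i, 0 <= phi i) ->
  walk_exp n (fun i => psi i + phi i) m = walk_exp n psi m + walk_exp n phi m.
Proof.
move=> psi0 phi0; elim: n m => [//|n IH] m /=.
rewrite -esumD; last 2 first.
- by move=> k _; rewrite mule_ge0 ?lee_fin// walk_exp_ge0.
- by move=> k _; rewrite mule_ge0 ?lee_fin// walk_exp_ge0.
by apply: eq_esum => k _; rewrite IH ge0_muleDr// walk_exp_ge0.
Qed.

Lemma walk_expZ n (c : \bar R) psi m : 0 <= c -> (forall i, 0 <= psi i) ->
  walk_exp n (fun i => c * psi i) m = c * walk_exp n psi m.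
Proof.
move=> c0 psi0; elim: n m => [//|n IH] m /=.
rewrite -esumZl//; last by move=> k; rewrite mule_ge0 ?lee_fin// walk_exp_ge0.
by apply: eq_esum => k _; rewrite IH muleCA.
Qed.

(** Each step costs at most a factor [r]; with an exponential [psi] this is the Chernoff bound. *)
Lemma walk_exp_supersolution (r : R) psi n m : (0 <= r)%R ->
  (forall i, 0 <= psi i) ->
  (forall i, \esum_(k in [set: nat]) ((nu k)%:E * psi (i + k)%N) <= r%:E * psi i) ->
  walk_exp n psi m <= (r ^+ n)%:E * psi m.
Proof.
move=> r0 psi0 Hpsi; elim: n m => [|n IH] m /=; first by rewrite expr0 mul1e.
apply: (@le_trans _ _ (\esum_(k in [set: nat]) ((r ^+ n)%:E * ((nu k)%:E * psi (m + k)%N)))).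
  by apply: le_esum => k _; rewrite muleCA lee_wpmul2l// lee_fin.
rewrite esumZl ?lee_fin ?exprn_ge0//; last by move=> k; rewrite mule_ge0// lee_fin.
by rewrite exprSr EFinM -muleA lee_wpmul2l// lee_fin exprn_ge0.
Qed.

Lemma esum_cvg (a : nat -> R) (l : R) : (forall k, 0 <= a k)%R ->
  (fun n => \sum_(0 <= k < n) a k)%R @ \oo --> l ->
  \esum_(k in [set: nat]) (a k)%:E = l%:E.
Proof.
move=> a0 al; rewrite -nneseries_esumT; last by move=> k; rewrite lee_fin.
apply/cvg_lim => //.
by under eq_fun do rewrite sumEFin; apply: cvg_EFin al; exact: nearW.
Qed.

Hypothesis nu_sum : (fun n => \sum_(0 <= k < n) nu k)%R @ \oo --> (1 : R)%R.

Lemma esum_nu : \esum_(k in [set: nat]) (nu k)%:E = 1.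
Proof. exact: esum_cvg. Qed.

Lemma walk_exp_cst n (c : \bar R) m : 0 <= c -> walk_exp n (cst c) m = c.
Proof.
move=> c0; elim: n m => [//|n IH] m /=.
under eq_esum do rewrite IH muleC.
by rewrite esumZl// ?esum_nu ?mule1// => k; rewrite lee_fin.
Qed.

(** As [nu] gives no mass to 0, every step is at least 1 and [n] steps from [m] end at [m + n] or
    beyond. *)
Lemma walk_exp_le_cst n psi (c : \bar R) m : nu 0%N = 0%R -> 0 <= c ->
  (forall i, (m + n <= i)%N -> psi i <= c) -> walk_exp n psi m <= c.
Proof.
move=> nu0 c0; elim: n m => [|n IH] m Hc /=; first by apply: Hc; rewrite addn0.
rewrite -[leRHS]mule1 -esum_nu -esumZl//.
apply: le_esum => -[|k] _; first by rewrite nu0 mul0e mule0.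
rewrite [leRHS]muleC lee_wpmul2l ?lee_fin//; apply: IH => i mi; apply: Hc.
by rewrite (leq_trans _ mi)//; lia.
Qed.

(** * Mean and lower tail of the walk *)

Section mean.
Variable mu : R.
Hypothesis nu_mean : (fun n => \sum_(0 <= k < n) k%:R * nu k)%R @ \oo --> mu.

Let kn_ge0 k : (0 <= k%:R * nu k)%R. Proof. by rewrite mulr_ge0. Qed.

Lemma esum_nu_mean : \esum_(k in [set: nat]) (k%:R * nu k)%:E = mu%:E.
Proof. exact: esum_cvg. Qed.

Lemma mean_ge0 : (0 <= mu)%R.
Proof. by rewrite -lee_fin -esum_nu_mean esum_ge0// => k _; rewrite lee_fin. Qed.

Lemma mean_ge1 : nu 0%N = 0%R -> (1 <= mu)%R.
Proof.
move=> nu0; rewrite -lee_fin -esum_nu_mean -esum_nu; apply: le_esum => -[|k] _.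
  by rewrite nu0 mulr0.
by rewrite lee_fin ler_peMl// ler1n.
Qed.

Lemma walk_exp_affine (A B : R) n m : (0 <= A)%R -> (0 <= B)%R ->
  walk_exp n (fun i => (A + B * i%:R)%:E) m = (A + B * (m%:R + n%:R * mu))%:E.
Proof.
move=> A0 B0; elim: n m => [|n IH] m /=; first by rewrite mul0r addr0.
pose c := (A + B * (m%:R + n%:R * mu))%R.
have c0 : (0 <= c)%R.
  by rewrite addr_ge0// mulr_ge0// addr_ge0// mulr_ge0// mean_ge0.
transitivity (\esum_(k in [set: nat]) (c%:E * (nu k)%:E + B%:E * (k%:R * nu k)%:E)).
  by apply: eq_esum => k _; rewrite IH -!EFinM -EFinD /c natrD; congr EFin; ring.
rewrite esumD; last 2 first.
- by move=> k _; rewrite mule_ge0// lee_fin.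
- by move=> k _; rewrite mule_ge0// lee_fin.
rewrite !esumZl ?lee_fin//.
rewrite esum_nu esum_nu_mean -!EFinM -EFinD /c; congr EFin.
by rewrite -natr1; ring.
Qed.

(** Both sides are compared with [(1 + x)^-1], using [(1 - x + x ^+ 2) * (1 + x) = 1 + x ^+ 3]. *)
Lemma expRN_le_quadratic (x : R) : (0 <= x -> expR (- x) <= 1 - x + x ^+ 2)%R.
Proof.
move=> x0; have x1 : (0 < 1 + x)%R by lra.
rewrite expRN; apply: (@le_trans _ _ (1 + x)^-1%R).
  by rewrite lef_pV2 ?posrE ?expR_gt0// expR_ge1Dx.
rewrite -[leLHS]mul1r ler_pdivrMr//.
have -> : ((1 - x + x ^+ 2) * (1 + x) = 1 + x ^+ 3)%R by ring.
by rewrite lerDl exprn_ge0.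
Qed.

(** Only a first moment is available, so the mean is truncated at a level [L] where it still exceeds
    [a' > a]. Below [L] the exponential is at most [1 - lam * k + lam ^+ 2 * L ^+ 2], beyond [L] it
    is at most 1; summing gives [1 + lam ^+ 2 * L ^+ 2 - lam * S], which [r] dominates. *)
Lemma laplace_nu_le (a : R) : (a < mu)%R ->
  exists2 lam : R, (0 < lam)%R & exists2 r : R, (0 < r)%R &
    \esum_(k in [set: nat]) (nu k * expR (- lam * k%:R))%:E <= r%:E /\
    (expR (lam * a) * r < 1)%R.
Proof.
move=> amu; pose a' := ((a + mu) / 2)%R.
have aa' : (a < a')%R by rewrite /a'; lra.
have a'mu : (a' < mu)%R by rewrite /a'; lra.
have [L L0 SL] : exists2 L : nat, (0 < L)%N & (a' < \sum_(0 <= k < L) k%:R * nu k)%R.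
  have /cvgr_gt/(_ _ a'mu)[N _ HN] := nu_mean.
  by exists N.+1 => //; apply: HN => /=.
set S := (\sum_(0 <= k < L) k%:R * nu k)%R in SL.
have L0' : (0 < L%:R :> R)%R by rewrite ltr0n.
(* The minimizer of [lam ^+ 2 * L ^+ 2 - lam * (a' - a)], the exponent of [expR (lam * a) * r]; the
   minimum is [- lam * (a' - a) / 2]. *)
pose lam := ((a' - a) / (2 * L%:R ^+ 2))%R.
have lam0 : (0 < lam)%R by rewrite divr_gt0 ?subr_gt0// mulr_gt0// exprn_gt0.
exists lam => //; exists (expR (- lam * a' + lam ^+ 2 * L%:R ^+ 2)) => //; first exact: expR_gt0.
split; last first.
  rewrite -expRD -[ltRHS]expR0 ltr_expR.
  have -> : (lam * a + (- lam * a' + lam ^+ 2 * L%:R ^+ 2) = - (lam * (a' - a) / 2))%R.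
    by rewrite /lam; field; rewrite gt_eqF.
  by rewrite oppr_lt0 divr_gt0// mulr_gt0// subr_gt0.
have trunc : \esum_(k in [set: nat]) (if (k < L)%N then lam * (k%:R * nu k) else 0)%R%:E = (lam * S)%:E.
  rewrite (@esum_seq _ _ (index_iota 0 L)) ?iota_uniq//.
  - rewrite sumEFin /S mulr_sumr; congr EFin; apply: eq_big_nat => k /andP[_ ->]//.
  - by move=> k; case: ifP; rewrite lee_fin// mulr_ge0// ltW.
  - by move=> k; rewrite mem_index_iota leq0n/= => /negbTE ->.
apply: (@le_trans _ _ ((1 + lam ^+ 2 * L%:R ^+ 2) - lam * S)%:E); last first.
  rewrite lee_fin; apply: le_trans (expR_ge1Dx _).
  by have := ltW SL; rewrite -(ler_pM2l lam0); lra.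
rewrite EFinB leeBrDr// -trunc -esumD; last 2 first.
- by move=> k _; rewrite lee_fin mulr_ge0// expR_ge0.
- by move=> k _; case: ifP; rewrite lee_fin// mulr_ge0// ltW.
rewrite -[(1 + _)%:E]mule1 -esum_nu -esumZl; last 2 first.
- by rewrite lee_fin addr_ge0// mulr_ge0// exprn_ge0// ltW.
- by move=> k; rewrite lee_fin.
apply: le_esum => k _; rewrite -EFinM -EFinD lee_fin.
have lk0 : (0 <= lam * k%:R)%R by rewrite mulr_ge0// ltW.
case: ifP => [kL|_].
  have kL2 : ((lam * k%:R) ^+ 2 <= lam ^+ 2 * L%:R ^+ 2)%R.
    rewrite exprMn ler_pM2l ?exprn_gt0// ler_pXn2r ?nnegrE ?ler0n//.
    by rewrite ler_nat ltnW.
  have := expRN_le_quadratic lk0; rewrite -mulNr => H.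
  have := nu_ge0 k; move: H kL2; move: (expR _) (nu k) => E p H kL2 p0; nra.
rewrite addr0 mulrC ler_wpM2r//.
apply: (@le_trans _ _ 1%R); first by rewrite -[leRHS]expR0 ler_expR mulNr oppr_le0.
by rewrite lerDl mulr_ge0// exprn_ge0// ltW.
Qed.

(** The integrand dominates the indicator of [i <= a * n], so this bounds the lower tail of the
    walk. One step multiplies it by at most [r], and it starts from [expR (lam * a * n)], hence
    [rho = expR (lam * a) * r]. *)
Lemma walk_chernoff (a : R) : (a < mu)%R ->
  exists2 lam : R, (0 < lam)%R & exists2 rho : R, (0 < rho < 1)%R &
    forall n, walk_exp n (fun i => (expR (lam * (a * n%:R - i%:R)))%:E) 0 <=
      (rho ^+ n)%:E.
Proof.
move=> /laplace_nu_le[lam lam0 [r r0 [rE rho1]]].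
exists lam => //; exists (expR (lam * a) * r)%R.
  by rewrite rho1 mulr_gt0 ?expR_gt0.
move=> n; apply: (@le_trans _ _ ((r ^+ n)%:E * (expR (lam * (a * n%:R - 0%:R)))%:E)).
  apply: (@walk_exp_supersolution r (fun i => (expR (lam * (a * n%:R - i%:R)))%:E)).
  - exact: ltW.
  - by move=> i; rewrite lee_fin expR_ge0.
  move=> i; rewrite [leRHS]muleC.
  apply: (@le_trans _ _ (\esum_(k in [set: nat]) ((expR (lam * (a * n%:R - i%:R)))%:E * (nu k * expR (- lam * k%:R))%:E))).
    apply: le_esum => k _; rewrite -!EFinM lee_fin mulrCA -expRD ler_wpM2l//.
    by rewrite ler_expR natrD; lra.
  rewrite esumZl ?lee_fin ?expR_ge0//; last by move=> k; rewrite lee_fin mulr_ge0// expR_ge0.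
  by rewrite lee_wpmul2l// lee_fin expR_ge0.
rewrite -EFinM lee_fin subr0 exprMn mulrC ler_wpM2r ?exprn_ge0 ?(ltW r0)//.
by rewrite mulrA -expRM_natr.
Qed.

End mean.
End walk.

(** * Law of the network *)

Section path.
Context {R : realType} (alpha theta : R) (nu : nat -> R).
Hypotheses (a0 : 0 < alpha) (a1 : alpha < 1) (ta : - alpha < theta).
Hypothesis nu_ge0 : forall k, 0 <= nu k.
Implicit Types (h e : seq nat) (es : network).

Lemma path_prob_ge0 h es : valid_history h -> 0 <= path_prob alpha theta nu h es.
Proof.
elim: es h => [|e es IH] h vh /=; first exact: ler01.
have [s0 sv] := seq_prob_valid a0 a1 ta e vh.
have [->|/sv vhe] := eqVneq (seq_prob alpha theta h e) 0; first by rewrite mulr0 mul0r.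
by rewrite !mulr_ge0// IH.
Qed.

Section weight.
Variables (q : R) (w W : nat -> R).
Hypotheses (w_ge0 : forall v, 0 <= w v) (W_gt0 : forall m, 0 < W m).
Hypotheses (w0 : w 0%N = w 1%N) (W0 : W 0%N = W 1%N).
Hypothesis wS : forall v, (0 < v)%N ->
  (theta + alpha * v%:R) * w v.+1 = (theta + alpha * v%:R + q) * w v.
Hypothesis WS : forall m, (0 < m)%N ->
  (m%:R + theta) * W m.+1 = (m%:R + theta + q) * W m.

Local Open Scope ereal_scope.
Local Notation hw := (hweight w W).

(** The independence of arities and labels. Sum over the first edge by size: for a fixed size [k],
    harmonicity replaces the weight by its value at [h] and leaves the factor [nu k], which is one
    step of the walk. This works because [psi] sees only the number of draws. *)
Lemma esum_path_hweight (psi : nat -> \bar R) n h :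
  (forall m, 0 <= psi m) -> valid_history h ->
  \esum_(es in [set es | size es = n])
    ((path_prob alpha theta nu h es * hw (h ++ flatten es))%:E *
      psi (size (h ++ flatten es)))
  = (hw h)%:E * walk_exp nu n psi (size h).
Proof.
move=> psi0.
have hw0 h' : (0 <= hw h')%R by exact: hweight_ge0.
have g0 h' es : valid_history h' -> 0 <= (path_prob alpha theta nu h' es *
    hw (h' ++ flatten es))%:E * psi (size (h' ++ flatten es)).
  by move=> vh; rewrite mule_ge0// lee_fin mulr_ge0// path_prob_ge0.
elim: n h => [|n IH] h vh.
  by rewrite esum_size0 ?g0//= cats0 mul1r.
rewrite esum_size_cons; last by move=> *; exact: g0.
transitivity (\esum_(e in [set: seq nat]) ((nu (size e) * seq_prob alpha theta h e)%:E *
    ((hw (h ++ e))%:E * walk_exp nu n psi (size h + size e)%N))).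
  apply: eq_esum => e _ /=; have [_ sv] := seq_prob_valid a0 a1 ta e vh.
  have [->|/sv vhe] := eqVneq (seq_prob alpha theta h e) 0%R.
    by rewrite mulr0 mul0e esum1// => es _; rewrite !mul0r mul0e.
  rewrite -size_cat -IH// -esumZl; last 2 first.
  - by rewrite lee_fin mulr_ge0// seq_prob_ge0.
  - by move=> es; exact: g0.
  by apply: eq_esum => es _; rewrite catA muleA -EFinM; congr (_%:E * _); ring.
have walk0 m : 0 <= walk_exp nu n psi m by exact: walk_exp_ge0.
rewrite esum_by_size; last first.
  by move=> e; rewrite !mule_ge0// lee_fin// mulr_ge0// seq_prob_ge0.
rewrite -esumZl ?lee_fin//; last by move=> k; rewrite mule_ge0// lee_fin.
apply: eq_esum => k _.
rewrite -(esum_seq_hweight a0 a1 ta w_ge0 W_gt0 w0 W0 wS WS k vh) muleC -esumZl; last 2 first.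
- by rewrite mule_ge0// lee_fin.
- by move=> e; rewrite lee_fin mulr_ge0// seq_prob_ge0.
apply: eq_esum => e /= ->; rewrite !EFinM -!muleA; congr (_ * _).
by rewrite [RHS]muleC -!muleA.
Qed.

Context {d : measure_display} {T : measurableType d} (P : probability T R).
Variable X : nat -> T -> seq nat.
Hypothesis hX : is_hollywood P alpha theta nu X.

Lemma measurable_Ynet n es : measurable [set t | Ynet X n t = es].
Proof.
have [sn|sn] := eqVneq (size es) n; last first.
  rewrite (_ : [set _ | _] = set0)//; apply/seteqP; split => // t /= Ht.
  by move/eqP: sn; apply; rewrite -Ht /Ynet size_map size_iota.
rewrite (_ : [set _ | _] = \bigcap_(i in [set i | (i < n)%N]) [set t | X i t = nth [::] es i]).
  by apply: bigcap_measurableType => i _; exact: hX.1.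
apply/seteqP; split => t /=.
  by move=> <- i /= ni; rewrite (nth_map 0%N) ?size_iota// nth_iota.
move=> H; apply: (@eq_from_nth _ [::]); rewrite size_map size_iota// => i ni.
by rewrite (nth_map 0%N) ?size_iota// nth_iota// H.
Qed.

Lemma integral_Ynet (F : network -> \bar R) n : (forall es, 0 <= F es) ->
  \int[P]_t F (Ynet X n t) =
  \esum_(es in [set es | size es = n]) ((path_prob alpha theta nu [::] es)%:E * F es).
Proof.
move=> F0; rewrite (ge0_integral_countType P (measurable_Ynet n) F0).
rewrite [RHS]esum_mkcond; apply: eq_esum => es _; case: ifPn.
  by move=> /set_mem /= <-; rewrite hX.2 muleC.
rewrite notin_setE/= => sn; rewrite (_ : [set _ | _] = set0) ?measure0 ?mule0//.
apply/seteqP; split => // t /= Ht.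
by apply: sn; rewrite -Ht /Ynet size_map size_iota.
Qed.

Lemma integral_hweight (psi : nat -> \bar R) n : (forall m, 0 <= psi m) ->
  \int[P]_t ((hw (flatten (Ynet X n t)))%:E * psi (size (flatten (Ynet X n t)))) =
  (w 1%N / W 1%N)%:E * walk_exp nu n psi 0%N.
Proof.
move=> psi0.
rewrite (@integral_Ynet (fun es => (hw (flatten es))%:E * psi (size (flatten es)))).
  have := esum_path_hweight n psi0 valid_nil; rewrite {2}/hweight/= w0 W0 => <-.
  by apply: eq_esum => es _ /=; rewrite muleA -EFinM.
by move=> es; rewrite mule_ge0// lee_fin hweight_ge0.
Qed.

(** The choice [psi = W] cancels the denominator of [hweight]. *)
Lemma integral_nverts n :
  \int[P]_t (w (nverts (Ynet X n t)))%:E =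
  (w 1%N / W 1%N)%:E * walk_exp nu n (EFin \o W) 0%N.
Proof.
rewrite -integral_hweight; last by move=> m; rewrite lee_fin ltW.
by apply: eq_integral => t _; rewrite -EFinM divfK ?gt_eqF.
Qed.

End weight.

Local Open Scope ereal_scope.
Context {d : measure_display} {T : measurableType d} (P : probability T R).
Variable X : nat -> T -> seq nat.
Hypothesis hX : is_hollywood P alpha theta nu X.

(** The constant weights [w = W = 1] satisfy both recursions with [q = 0], so only the walk
    remains. *)
Lemma integral_size_flatten (psi : nat -> \bar R) n : (forall m, 0 <= psi m) ->
  \int[P]_t psi (size (flatten (Ynet X n t))) = walk_exp nu n psi 0%N.
Proof.
move=> psi0; have c1 : forall m : nat, (0 <= 1 :> R)%R by [].
have c1' : forall m : nat, (0 < 1 :> R)%R by [].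
have := @integral_hweight 0 (fun=> 1%R) (fun=> 1%R) c1 c1' erefl erefl _ _ d T P X hX psi n psi0.
rewrite divr1 mul1e => <-; first by apply: eq_integral => t _; rewrite /hweight divr1 mul1e.
- by move=> v _; rewrite addr0.
- by move=> m _; rewrite addr0.
Qed.

(** Markov's inequality, with [F] any nonnegative majorant of the indicator of [A]. *)
Lemma prob_Ynet_le (A : set network) (F : network -> \bar R) n :
  (forall es, 0 <= F es) -> (forall es, A es -> 1 <= F es) ->
  P [set t | A (Ynet X n t)] <= \int[P]_t F (Ynet X n t).
Proof.
move=> F0 AF; have mY := measurable_Ynet hX n.
have mA : measurable [set t | A (Ynet X n t)] by exact: (measurable_preimage_countType mY A).
rewrite -[leLHS]mul1e -integral_cst//.
apply: (@le_trans _ _ (\int[P]_(t in [set t | A (Ynet X n t)]) F (Ynet X n t))).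
  apply: ge0_le_integral => //; last by move=> t /AF.
  by apply: measurable_funTS; exact: (measurable_fun_countType mY).
by apply: ge0_subset_integral => //; exact: (measurable_fun_countType mY).
Qed.

End path.

(** * Gamma weights *)

Section powR_limit.
Context {R : realType}.

Lemma invr_powR (x r : R) : 0 < x -> x^-1 `^ r = (x `^ r)^-1.
Proof. by move=> x0; rewrite -powR_inv1 ?(ltW x0)// -powRrM mulN1r powRN. Qed.

Lemma cvg_powR_inv (c r : R) : 0 < c -> 0 < r ->
  ((c * n.+1%:R)^-1 `^ r) @[n --> \oo] --> (0 : R).
Proof.
move=> c0 r0; have /cvg_at_rightP := @powR_cvg0 R r r0; apply; split.
  by move=> n; rewrite invr_gt0 mulr_gt0.
rewrite -[X in _ --> X](mulr0 c^-1); under eq_cvg do rewrite invfM.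
by apply: cvgM; [exact: cvg_cst|exact: cvg_harmonic].
Qed.

End powR_limit.

(** * Wendel's bounds for ratios of gamma values *)

Section gamma_ratio.
Context {R : realType}.
Implicit Types (x y s c : R).

Definition gamma_ratio x s : R := Gamma (x + s) / Gamma x.

Lemma gamma_ratio_gt0 x s : 0 < x -> 0 < x + s -> 0 < gamma_ratio x s.
Proof. by move=> x0 xs0; rewrite divr_gt0// Gamma_gt0. Qed.

Lemma gamma_ratioD1 x s : 0 < x -> 0 < x + s ->
  x * gamma_ratio (x + 1) s = (x + s) * gamma_ratio x s.
Proof.
move=> x0 xs0; rewrite /gamma_ratio addrAC !GammaD1//.
by field; rewrite !gt_eqF// Gamma_gt0.
Qed.

Lemma gamma_ratio1 x : 0 < x -> gamma_ratio x 1 = x.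
Proof. by move=> x0; rewrite /gamma_ratio GammaD1// mulfK// gt_eqF// Gamma_gt0. Qed.

Lemma gamma_ratio_le x s : 0 < x -> 0 <= s <= 1 -> gamma_ratio x s <= x `^ s.
Proof. by move=> x0 s01; rewrite ler_pdivrMr ?Gamma_gt0//; exact: Gamma_le_powR. Qed.

Lemma gamma_ratio_ge x s : 1 <= x -> 0 <= s <= 1 -> x `^ s - 1 <= gamma_ratio x s.
Proof.
move=> x1 s01; have /andP[s0 s1] := s01; have x0 : 0 < x by lra.
have xs0 : 0 < x + s by lra.
apply: (@le_trans _ _ (x / (x + s) `^ (1 - s))); last first.
  rewrite ler_pdivlMr ?Gamma_gt0// mulrAC; exact: Gamma_ge_powR.
have -> : x / (x + s) `^ (1 - s) = (x + s) `^ s - s * (x + s) `^ (s - 1).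
  have -> : (x + s) `^ s = (x + s) * (x + s) `^ (s - 1).
    rewrite -[X in _ = X * _]powRr1 ?(ltW xs0)// -powRD ?(gt_eqF xs0) ?implybT//.
    by congr (_ `^ _); ring.
  by rewrite -powRN opprB; ring.
apply: lerB; first by apply: ge0_ler_powR; rewrite ?nnegrE//; lra.
rewrite mulr_ile1// ?powR_ge0// -[leRHS](powRr0 (x + s)).
by apply: ler_powR; lra.
Qed.

Lemma gamma_ratioN_ge x s : 0 < x - s -> 0 <= s <= 1 ->
  (x `^ s)^-1 <= gamma_ratio x (- s).
Proof.
move=> xs0 s01; have /andP[s0 s1] := s01; have x0 : 0 < x by lra.
rewrite /gamma_ratio ler_pdivlMr ?Gamma_gt0// mulrC ler_pdivrMr ?powR_gt0//.
have := Gamma_le_powR xs0 s01; rewrite subrK => /le_trans; apply.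
rewrite mulrC ler_pM2l ?Gamma_gt0//.
by apply: ge0_ler_powR; rewrite ?nnegrE; lra.
Qed.

(** Wendel's lower bound based at [x - s], read as an upper bound for [Gamma (x - s)]. *)
Lemma gamma_ratioN_le x s : 0 < x - s -> 0 <= s <= 1 ->
  gamma_ratio x (- s) <= x / (x - s) * (x `^ s)^-1.
Proof.
move=> xs0 s01; have /andP[s0 s1] := s01; have x0 : 0 < x by lra.
rewrite /gamma_ratio ler_pdivrMr ?Gamma_gt0//.
have := Gamma_ge_powR xs0 s01; rewrite subrK => H.
have -> : x / (x - s) * (x `^ s)^-1 = x `^ (1 - s) / (x - s).
  rewrite powRB ?(gt_eqF x0) ?implybT// powRr1 ?(ltW x0)//; ring.
move: H; rewrite ler_pdivrMr ?powR_gt0// => H.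
by rewrite mulrAC ler_pdivlMr// mulrC (le_trans H)// mulrC.
Qed.

End gamma_ratio.

Section weights.
Context {R : realType} (alpha theta p : R).
Hypotheses (a0 : 0 < alpha) (a1 : alpha < 1) (ta : - alpha < theta).
Hypothesis p0 : 0 < 1 + theta / alpha + p.

(** The [maxn] makes the values at 0 and 1 agree, as the step from the empty history requires, and
    keeps the gamma arguments positive when [theta] is negative. *)
Definition wvert v : R := gamma_ratio ((maxn v 1)%:R + theta / alpha) p.
Definition Wsize m : R := gamma_ratio ((maxn m 1)%:R + theta) (alpha * p).

Let maxn_ge1 n : 1 <= (maxn n 1)%:R :> R.
Proof. by rewrite ler1n leq_max leqnn orbT. Qed.

Let b1 : 0 < 1 + theta / alpha.
Proof.
by rewrite -(@divff _ alpha) ?gt_eqF// -mulrDl divr_gt0//; move: ta; lra.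
Qed.

Lemma alpha_theta_p : 0 < alpha + theta + alpha * p.
Proof.
have : 0 < alpha * (1 + theta / alpha + p) by rewrite mulr_gt0.
rewrite (_ : _ * (_ + _) = alpha + theta + alpha * p)//; field.
by rewrite gt_eqF.
Qed.

Lemma vert_arg_gt0 v : 0 < (maxn v 1)%:R + theta / alpha.
Proof. by move: b1 (maxn_ge1 v); lra. Qed.

Lemma vert_arg_p_gt0 v : 0 < (maxn v 1)%:R + theta / alpha + p.
Proof. by move: p0 (maxn_ge1 v); lra. Qed.

Lemma size_arg_gt0 m : 0 < (maxn m 1)%:R + theta.
Proof. by move: a1 ta (maxn_ge1 m); lra. Qed.

Lemma size_arg_p_gt0 m : 0 < (maxn m 1)%:R + theta + alpha * p.
Proof. by move: a1 alpha_theta_p (maxn_ge1 m); lra. Qed.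

Lemma wvert_gt0 v : 0 < wvert v.
Proof. exact: gamma_ratio_gt0 (vert_arg_gt0 v) (vert_arg_p_gt0 v). Qed.

Lemma Wsize_gt0 m : 0 < Wsize m.
Proof. exact: gamma_ratio_gt0 (size_arg_gt0 m) (size_arg_p_gt0 m). Qed.

(** The recursion of the gamma ratio times [alpha]: this turns the shift [p] into [alpha * p], the
    shift used in [Wsize], so that both recursions share the same [q]. *)
Lemma wvertS v : (0 < v)%N ->
  (theta + alpha * v%:R) * wvert v.+1 = (theta + alpha * v%:R + alpha * p) * wvert v.
Proof.
move=> v0; have := gamma_ratioD1 (vert_arg_gt0 v) (vert_arg_p_gt0 v).
rewrite -/(wvert v) addrAC natr1 (_ : (maxn v 1).+1 = maxn v.+1 1); last by lia.
rewrite -/(wvert v.+1) (_ : maxn v 1 = v); last by lia.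
move=> /(congr1 ( *%R alpha)); rewrite !mulrA => H.
have an0 : alpha != 0 by rewrite gt_eqF.
have -> : theta + alpha * v%:R = alpha * (v%:R + theta / alpha) by field.
by rewrite H -mulrDr.
Qed.

Lemma WsizeS m : (0 < m)%N ->
  (m%:R + theta) * Wsize m.+1 = (m%:R + theta + alpha * p) * Wsize m.
Proof.
move=> m0; have := gamma_ratioD1 (size_arg_gt0 m) (size_arg_p_gt0 m).
rewrite -/(Wsize m) addrAC natr1 (_ : (maxn m 1).+1 = maxn m.+1 1); last by lia.
by rewrite -/(Wsize m.+1) (_ : maxn m 1 = m); last by lia.
Qed.

Lemma integral_wvert (nu : nat -> R) (d : measure_display) (T : measurableType d)
    (P : probability T R) (X : nat -> T -> seq nat) n :
  (forall k, 0 <= nu k) -> is_hollywood P alpha theta nu X ->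
  (\int[P]_t (wvert (nverts (Ynet X n t)))%:E =
   (wvert 1 / Wsize 1)%:E * walk_exp nu n (EFin \o Wsize) 0%N)%E.
Proof.
move=> nu0 hX; apply: (integral_nverts a0 a1 ta nu0 _ _ _ _ wvertS WsizeS) => //.
- by move=> v; exact/ltW/wvert_gt0.
- exact: Wsize_gt0.
Qed.

End weights.

(** * Expected number of vertices *)

Section expected_vertices.
Context {R : realType} (alpha theta mu : R) (nu : nat -> R).
Hypotheses (a0 : 0 < alpha) (a1 : alpha < 1) (ta : - alpha < theta).
Hypotheses (nu_ge0 : forall k, 0 <= nu k) (nu0 : nu 0%N = 0).
Hypothesis nu_sum : (fun n => \sum_(0 <= k < n) nu k) @ \oo --> (1 : R).
Hypothesis nu_mean : (fun n => \sum_(0 <= k < n) k%:R * nu k) @ \oo --> mu.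

Local Notation b := (theta / alpha).
Local Notation w := (wvert alpha theta 1).
Local Notation W := (Wsize alpha theta 1).
Local Notation C := (Gamma (theta + 1) / (alpha * Gamma (theta + alpha))).

Lemma weight1_gt0 : 0 < 1 + b + 1.
Proof.
rewrite addr_gt0// -(@divff _ alpha) ?gt_eqF// -mulrDl divr_gt0//; move: ta; lra.
Qed.

Lemma wvert1E v : w v = (maxn v 1)%:R + b.
Proof. exact/gamma_ratio1/vert_arg_gt0. Qed.

(** Here [w 1 = (theta + alpha) / alpha], and the functional equation extracts the same factor
    [theta + alpha] from the numerator of [W 1]. *)
Lemma weight1_coef : w 1%N / W 1%N = C.
Proof.
rewrite wvert1E /Wsize /gamma_ratio /= mulr1 maxnn.
have ta0 : 0 < theta + alpha by move: ta; lra.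
have t1 : 0 < 1 + theta by move: a1 ta; lra.
rewrite [1 + theta + alpha](_ : _ = theta + alpha + 1); last by ring.
rewrite GammaD1// [1 + theta]addrC.
by field; rewrite !gt_eqF ?Gamma_gt0//; lra.
Qed.

Lemma coef_gt0 : 0 < C.
Proof.
have ta0 : 0 < theta + alpha by move: ta; lra.
have t1 : 0 < theta + 1 by move: a1 ta; lra.
by rewrite divr_gt0 ?mulr_gt0 ?Gamma_gt0.
Qed.

(* Jensen's inequality, through the tangent to [x `^ alpha] at the mean. *)
Lemma walk_Wsize_le n : (walk_exp nu n (EFin \o W) 0%N <=
  ((mu * n%:R + (1 + `|theta|)) `^ alpha)%:E)%E.
Proof.
set c := 1 + `|theta|; have c1 : 1 <= c by rewrite lerDl.
have mu0 := mean_ge0 nu_ge0 nu_mean.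
have a01 : 0 <= alpha <= 1 by move: a0 a1; lra.
pose y := mu * n%:R + c.
have y0 : 0 < y.
  by rewrite ltr_wpDl ?mulr_ge0//; move: c1; lra.
pose A := y `^ alpha * (1 - alpha + alpha * (c / y)).
pose B := y `^ alpha * (alpha / y).
have A0 : 0 <= A.
  rewrite mulr_ge0 ?powR_ge0// addr_ge0 ?subr_ge0 ?(ltW a1)// mulr_ge0 ?(ltW a0)//.
  by rewrite divr_ge0 ?(ltW y0)//; move: c1; lra.
have B0 : 0 <= B by rewrite mulr_ge0 ?powR_ge0// divr_ge0// ltW.
apply: (@le_trans _ _ (walk_exp nu n (fun m => (A + B * m%:R)%:E) 0%N)).
  apply: le_walk_exp => // m; rewrite lee_fin.
  have x0 := size_arg_gt0 a1 ta m.
  have ge0c : 0 <= m%:R + c by rewrite addr_ge0//; move: c1; lra.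
  rewrite /Wsize mulr1; apply: (le_trans (gamma_ratio_le x0 a01)).
  apply: (@le_trans _ _ ((m%:R + c) `^ alpha)).
    apply: ge0_ler_powR; rewrite ?nnegrE ?(ltW a0) ?(ltW x0)//.
    have := ler_norm theta; rewrite /c.
    have : (maxn m 1)%:R <= m%:R + 1 :> R by rewrite natr1 ler_nat geq_max leqnSn.
    lra.
  apply: (le_trans (powR_le_tangent y0 a01 ge0c)).
  by rewrite le_eqVlt; apply/orP; left; apply/eqP; rewrite /A /B; ring.
rewrite (walk_exp_affine nu_ge0 nu_sum nu_mean)// lee_fin.
rewrite le_eqVlt; apply/orP; left; apply/eqP; rewrite /A /B add0r.
have -> : n%:R * mu = y - c by rewrite /y; ring.
by field; rewrite gt_eqF.
Qed.

(** With [K] the bracket, [K <= W m + K * expR (lam * (a * n - m))] for every [m]: if [m >= a * n]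
    then [W m >= K], otherwise the exponential is at least 1. Take expectations and apply the
    Chernoff bound. *)
Lemma walk_Wsize_ge (a : R) : 0 < a -> a < mu -> exists2 rho : R, 0 < rho < 1 &
  forall n, 1 <= a * n%:R + theta ->
  ((((a * n%:R + theta) `^ alpha - 1) * (1 - rho ^+ n))%:E <=
     walk_exp nu n (EFin \o W) 0%N)%E.
Proof.
move=> ap amu.
have [lam lam0 [rho rho01 H]] := walk_chernoff nu_ge0 nu_sum nu_mean amu.
exists rho => // n an1.
set K := (a * n%:R + theta) `^ alpha - 1.
have K0 : 0 <= K.
  by rewrite subr_ge0 -[leLHS](powRr0 (a * n%:R + theta)); apply: ler_powR => //; exact: ltW.
have a01 : 0 <= alpha <= 1 by move: a0 a1; lra.
rewrite mulrBr mulr1 EFinB leeBlDr//.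
apply: (@le_trans _ _ (walk_exp nu n (EFin \o W) 0%N +
   K%:E * walk_exp nu n (fun i => (expR (lam * (a * n%:R - i%:R)))%:E) 0)%E); last first.
  by rewrite leeD2l// EFinM lee_wpmul2l// lee_fin.
have W0 m : (0 <= (EFin \o W) m)%E by rewrite lee_fin ltW// Wsize_gt0// weight1_gt0.
rewrite -walk_expZ// -?walk_expD//; last by move=> m; rewrite mule_ge0// lee_fin// expR_ge0.
rewrite -[leLHS](@walk_exp_cst _ nu nu_ge0 nu_sum n _ 0%N) ?lee_fin//.
apply: le_walk_exp => // m; rewrite /= -EFinM -EFinD lee_fin.
have [anm|man] := leP (a * n%:R) m%:R.
  rewrite ler_wpDr ?mulr_ge0 ?expR_ge0//.
  have mm : m%:R <= (maxn m 1)%:R :> R by rewrite ler_nat leq_maxl.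
  have x1 : 1 <= (maxn m 1)%:R + theta by lra.
  rewrite /Wsize mulr1; apply: le_trans (gamma_ratio_ge x1 a01).
  by rewrite /K lerD2r; apply: ge0_ler_powR; rewrite ?nnegrE//; move: a0; lra.
have W0' : 0 <= W m by move: (W0 m); rewrite lee_fin.
apply: ler_wpDl => //; rewrite -[leLHS]mulr1 ler_wpM2l//.
by rewrite -[leLHS]expR0 ler_expR mulr_ge0 ?(ltW lam0)// subr_ge0 ltW.
Qed.

Context {d : measure_display} {T : measurableType d} (P : probability T R).
Variable X : nat -> T -> seq nat.
Hypothesis hX : is_hollywood P alpha theta nu X.

(** The weight [w v = maxn v 1 + b] differs from [v] by at most [1 + |b|], and its expectation is
    exactly [C] times the walk term. Both quantities are finite, so [fine] loses nothing. *)
Lemma expectation_nverts n :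
  `|fine ('E_P[fun t => (nverts (Ynet X n t))%:R])%E -
    C * fine (walk_exp nu n (EFin \o W) 0%N)| <= 1 + `|b|.
Proof.
have mY (F : network -> \bar R) : measurable_fun [set: T] (fun t => F (Ynet X n t)).
  exact: (measurable_fun_countType (measurable_Ynet hX n)).
have W0 m : (0 <= (EFin \o W) m)%E by rewrite lee_fin ltW// Wsize_gt0// weight1_gt0.
have w0 v : (0 <= (w v)%:E)%E by rewrite lee_fin ltW// wvert_gt0// weight1_gt0.
have D0 : (0 <= walk_exp nu n (EFin \o W) 0)%E by exact: walk_exp_ge0.
have Dfin : walk_exp nu n (EFin \o W) 0%N \is a fin_num.
  by rewrite ge0_fin_numE//; apply: le_lt_trans (walk_Wsize_le n) _; exact: ltry.
have := integral_wvert a0 a1 ta weight1_gt0 n nu_ge0 hX.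
rewrite weight1_coef -(fineK Dfin); set D := fine _; rewrite -EFinM => Iw.
rewrite unlock; set V := (\int[P]_t _)%E.
have V0 : (0 <= V)%E by exact: integral_ge0.
have PT : P [set: T] = 1%E by exact: probability_setT.
have b0 : (0 <= `|b|%:E)%E by rewrite lee_fin.
have b10 : (0 <= (1 + `|b|)%:E)%E by rewrite lee_fin addr_ge0.
have lb := ler_norm b; have lb' := ler_norm (- b); rewrite normrN in lb'.
have V1 : (V <= (C * D + `|b|)%:E)%E.
  rewrite EFinD -Iw -[`|b|%:E]mule1 -PT -(integral_cst P measurableT) -ge0_integralD//.
  - apply: ge0_le_integral => //.
    + exact: (mY (fun es => (nverts es)%:R%:E)).
    + by apply: emeasurable_funD => //; exact: (mY (fun es => (w (nverts es))%:E)).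
    + move=> t _; rewrite -EFinD lee_fin wvert1E.
      have : (nverts (Ynet X n t))%:R <= (maxn (nverts (Ynet X n t)) 1)%:R :> R by rewrite ler_nat leq_maxl.
      by move: lb'; lra.
  - exact: (mY (fun es => (w (nverts es))%:E)).
have Vfin : V \is a fin_num.
  by rewrite ge0_fin_numE//; apply: le_lt_trans V1 _; exact: ltry.
have V2 : ((C * D)%:E <= V + (1 + `|b|)%:E)%E.
  rewrite -Iw -[(1 + `|b|)%:E]mule1 -PT -(integral_cst P measurableT) -ge0_integralD//.
  - apply: ge0_le_integral => //.
    + exact: (mY (fun es => (w (nverts es))%:E)).
    + by apply: emeasurable_funD => //; exact: (mY (fun es => (nverts es)%:R%:E)).
    + move=> t _; rewrite -EFinD lee_fin wvert1E.
      have : (maxn (nverts (Ynet X n t)) 1)%:R <= (nverts (Ynet X n t))%:R + 1 :> R by rewrite natr1 ler_nat geq_max leqnSn.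
      by move: lb; lra.
  - exact: (mY (fun es => (nverts es)%:R%:E)).
rewrite -(fineK Vfin) in V1 V2; rewrite ler_norml; move: V1 V2.
by rewrite -EFinD !lee_fin /= => V1 V2; apply/andP; split; move: (C * D) V1 V2 => CD; lra.
Qed.


(** Put [z = mu * n.+1]. After division by [C * z]^ alpha[, the expectation is within]kap * z
    [^ (- alpha)] of the normalized walk term, which lies below [1 + c / z] and, for every small
    [del], eventually above [1 - 3 * del]. *)
Lemma expectation_nverts_equiv :
  ((fun n : nat =>
      fine ('E_P[fun t => (nverts (Ynet X n.+1 t))%:R])%E
      / (C * (mu * n.+1%:R) `^ alpha)) @ \oo --> (1 : R)).
Proof.
have mu1 := mean_ge1 nu_ge0 nu_sum nu_mean nu0.
have [CC CCE] : {CC : R | CC = C} by exists C.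
have C0 : 0 < CC by rewrite CCE; exact: coef_gt0.
rewrite -CCE.
pose c := 1 + `|theta|; pose kap := (1 + `|b|) / CC.
have c0 : 0 < c by rewrite /c ltr_wpDr.
have kap0 : 0 <= kap by rewrite divr_ge0 ?addr_ge0// ltW.
pose z n : R := mu * n.+1%:R.
have z0 n : 0 < z n by rewrite mulr_gt0//; move: mu1; lra.
pose e n := fine ('E_P[fun t => (nverts (Ynet X n.+1 t))%:R])%E.
pose D n := walk_exp nu n.+1 (EFin \o W) 0%N.
have W0 m : (0 <= (EFin \o W) m)%E by rewrite lee_fin ltW// Wsize_gt0// weight1_gt0.
have Dfin n : D n \is a fin_num.
  rewrite ge0_fin_numE ?walk_exp_ge0//.
  by apply: le_lt_trans (walk_Wsize_le n.+1) _; exact: ltry.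
have zV n : (z n `^ alpha)^-1 = (z n)^-1 `^ alpha by rewrite invr_powR.
have za0 n : 0 < z n `^ alpha by rewrite powR_gt0.
have eD n : `|e n / (CC * z n `^ alpha) - fine (D n) * (z n)^-1 `^ alpha| <=
    kap * (z n)^-1 `^ alpha.
  have H := expectation_nverts n.+1; rewrite -CCE in H.
  rewrite -zV (_ : _ - _ = (e n - CC * fine (D n)) / (CC * z n `^ alpha)); last first.
    by field; rewrite !gt_eqF.
  rewrite normrM [X in _ * X]ger0_norm; last by rewrite invr_ge0 ltW// mulr_gt0.
  rewrite ler_pdivrMr ?mulr_gt0// /kap.
  apply: (le_trans H); rewrite le_eqVlt; apply/orP; left; apply/eqP; field.
  by rewrite !gt_eqF.
have up n : fine (D n) * (z n)^-1 `^ alpha <= 1 + c * (z n)^-1.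
  have H : fine (D n) <= (z n + c) `^ alpha.
    by rewrite -lee_fin fineK//; exact: walk_Wsize_le.
  have zc : 0 <= z n + c by rewrite addr_ge0// ltW.
  have a01 : 0 <= alpha <= 1 by move: a0 a1; lra.
  have := le_trans H (powR_le_tangent (z0 n) a01 zc).
  rewrite -zV ler_pdivrMr// [in leRHS]mulrC => /le_trans; apply.
  rewrite ler_pM2r//; have -> : (z n + c) / z n = 1 + c / z n by field; rewrite gt_eqF.
  have : 0 <= c / z n by rewrite divr_ge0 ?ltW.
  by move: a1; move: (c / z n) => u *; nra.
have mu0 : 0 < mu by lra.
have cz := cvg_powR_inv mu0 a0.
have cz1 : (z n)^-1 @[n --> \oo] --> (0 : R).
  have := cvg_powR_inv mu0 ltr01; under eq_cvg do rewrite powRr1 ?invr_ge0 ?(ltW (z0 _))//.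
  exact.
have low del : 0 < del < 1 / 2 -> \forall n \near \oo,
    1 - 3 * del <= fine (D n) * (z n)^-1 `^ alpha.
  move=> /andP[d0 d1]; pose a := (1 - del) * mu.
  have ap : 0 < a by rewrite mulr_gt0//; lra.
  have amu : a < mu by rewrite /a; nra.
  have [rho /andP[r0 r1] H] := walk_Wsize_ge ap amu.
  have crho : rho ^+ n.+1 @[n --> \oo] --> (0 : R).
    have /cvg_expr : `|rho| < 1 by rewrite ger0_norm ?ltW.
    by rewrite -(cvg_shiftS (fun n => rho ^+ n)).
  have cL : ((1 - 2 * del) - (z n)^-1 `^ alpha) * (1 - rho ^+ n.+1) @[n --> \oo] -->
      ((1 - 2 * del) - 0) * (1 - 0).
    by apply: cvgM; apply: cvgB => //; exact: cvg_cst.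
  rewrite !subr0 mulr1 in cL.
  have L1 : 1 - 3 * del < 1 - 2 * del by lra.
  have t1 : 0 < `|theta| + 1 by rewrite ltr_wpDl.
  near=> n.
  have nL : 1 - 3 * del <= ((1 - 2 * del) - (z n)^-1 `^ alpha) * (1 - rho ^+ n.+1).
    near: n; exact: (cvgr_ge _ cL).
  have nt : (z n)^-1 <= del / (`|theta| + 1).
    by near: n; apply: (cvgr_le _ cz1); rewrite divr_gt0.
  apply: (le_trans nL).
  have dz : `|theta| + 1 <= del * z n.
    move: nt; rewrite ler_pdivlMr// -ler_pdivlMl ?invr_gt0// invrK [z n * _]mulrC.
    by [].
  have zz : a * n.+1%:R = (1 - 2 * del) * z n + del * z n by rewrite /a /z; ring.
  have tt := ler_norm (- theta); rewrite normrN in tt.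
  have dz2 : 0 < (1 - 2 * del) * z n by rewrite mulr_gt0//; lra.
  have an1 : (1 - 2 * del) * z n + 1 <= a * n.+1%:R + theta by rewrite zz; lra.
  have := H n.+1 _; rewrite -/(D n) -(fineK (Dfin n)) lee_fin => Hn.
  have {}Hn : ((a * n.+1%:R + theta) `^ alpha - 1) * (1 - rho ^+ n.+1) <= fine (D n).
    by apply: Hn; lra.
  rewrite -zV ler_pdivlMr//; apply: le_trans Hn.
  rewrite mulrAC ler_wpM2r//.
    by rewrite subr_ge0 exprn_ile1// ltW.
  rewrite mulrBl mulVf ?gt_eqF// lerD2r.
  apply: (@le_trans _ _ (((1 - 2 * del) * z n) `^ alpha)); last first.
    by apply: ge0_ler_powR; rewrite ?nnegrE ?(ltW a0)//; lra.
  rewrite [leRHS]powRM ?(ltW (z0 n))//; last by lra.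
  rewrite ler_wpM2r ?powR_ge0//; apply: ger1_powR; last exact: ltW.
  by apply/andP; split; lra.
apply/cvgrPdist_le => eps eps0.
(* So that [3 * del] plus one further error [eps / 8] stays below [eps], with [del < 1 / 2]. *)
pose del := Num.min (eps / 8) (1 / 4).
have del1 : del <= eps / 8 by rewrite ge_min lexx.
have del2 : del <= 1 / 4 by rewrite ge_min lexx orbT.
have del0 : 0 < del by rewrite lt_min; apply/andP; split; lra.
have del01 : 0 < del < 1 / 2 by lra.
have ck : kap * (z n)^-1 `^ alpha @[n --> \oo] --> (0 : R).
  by rewrite -[X in _ --> X](mulr0 kap); apply: cvgM => //; exact: cvg_cst.
have cc : c * (z n)^-1 @[n --> \oo] --> (0 : R).
  by rewrite -[X in _ --> X](mulr0 c); apply: cvgM => //; exact: cvg_cst.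
have eps8 : 0 < eps / 8 by lra.
near=> n.
have k1 : kap * (z n)^-1 `^ alpha <= eps / 8 by near: n; exact: (cvgr_le _ ck).
have nz1 : c * (z n)^-1 <= eps / 8 by near: n; exact: (cvgr_le _ cc).
have nlow : 1 - 3 * del <= fine (D n) * (z n)^-1 `^ alpha by near: n; exact: low.
rewrite distrC ler_norml.
have := eD n; rewrite ler_norml => /andP[e1 e2].
have := up n; rewrite -/(z n) -/(e n) => u1.
by apply/andP; split; lra.
Unshelve. all: by end_near.
Qed.

End expected_vertices.

(** * Tail of the number of vertices *)

Section vertex_tail.
Context {R : realType} (alpha theta : R) (nu : nat -> R).
Hypotheses (a0 : 0 < alpha) (a1 : alpha < 1) (ta : - alpha < theta).
Hypotheses (nu_ge0 : forall k, 0 <= nu k) (nu0 : nu 0%N = 0).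
Hypothesis nu_sum : (fun n => \sum_(0 <= k < n) nu k) @ \oo --> (1 : R).
Context {d : measure_display} {T : measurableType d} (P : probability T R).
Variable X : nat -> T -> seq nat.
Hypothesis hX : is_hollywood P alpha theta nu X.
Local Notation b := (theta / alpha).

(** Markov's inequality for the weight with shift [- p], which decreases like [v]^ (- p)[and so is
    large when there are few vertices. Its expectation is a constant times that of]W[at the number
    of draws; this number is at least]n[, and]W[is of order]n [^ (- alpha * p)] or smaller there. *)
Lemma nverts_tail : exists2 p : R, 0 < p & exists2 K : R, 0 < K &
  forall (n : nat) (x : R), (0 < n)%N -> 1 <= x ->
  (P [set t | ((nverts (Ynet X n t))%:R <= x)%R] <=
    (K * x `^ p * (n%:R `^ (alpha * p))^-1)%:E)%E.
Proof.
have b1 : 0 < 1 + b.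
  by rewrite -(@divff _ alpha) ?gt_eqF// -mulrDl divr_gt0//; move: ta; lra.
(* Below [1 + b], to keep the gamma arguments positive, and below 1, the range of Wendel's
   inequalities. *)
pose p := Num.min 1 (1 + b) / 2.
have p2b : 2 * p <= 1 + b by rewrite /p mulrC divfK// ge_min lexx orbT.
have p21 : 2 * p <= 1 by rewrite /p mulrC divfK// ge_min lexx.
have p0 : 0 < p by rewrite divr_gt0// lt_min ltr01.
have q0 : 0 < 1 + b + - p by lra.
pose s := alpha * p.
have s0 : 0 < s by rewrite mulr_gt0.
have s1 : s <= 1 by apply: mulr_ile1; rewrite ?(ltW a0) ?(ltW p0) ?(ltW a1)//; lra.
have s01 : 0 <= s <= 1 by rewrite (ltW s0).
have p01 : 0 <= p <= 1 by lra.
have ts : 0 < 1 + theta - s.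
  by have := alpha_theta_p a0 q0; rewrite mulrN -/s; move: a1; lra.
have t1 : 0 < 1 + theta by lra.
(* Chosen so that [c0 * n <= m + theta] whenever [1 <= n <= m], for either sign of [theta]. *)
pose c0 := Num.min 1 (1 + theta).
have c00 : 0 < c0 by rewrite lt_min ltr01.
have c01 : c0 <= 1 by rewrite ge_min lexx.
have c0t : c0 <= 1 + theta by rewrite ge_min lexx orbT.
(* The largest value of [x / (x - s)] for [x >= 1 + theta]. *)
pose K1 := (1 + theta) / (1 + theta - s).
have K10 : 0 < K1 by rewrite divr_gt0.
pose w := wvert alpha theta (- p); pose W := Wsize alpha theta (- p).
have w0 v : 0 < w v by exact: wvert_gt0.
have W0 m : 0 < W m by exact: Wsize_gt0.
have Wle n m : (0 < n)%N -> (n <= m)%N -> W m <= K1 * ((c0 * n%:R) `^ s)^-1.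
  move=> n0 nm; have m1 : maxn m 1 = m by apply/maxn_idPl; exact: leq_trans nm.
  have n1R : 1 <= n%:R :> R by rewrite ler1n.
  have nmR : n%:R <= m%:R :> R by rewrite ler_nat.
  rewrite /W /Wsize mulrN -/s m1; set x := m%:R + theta.
  have xs : 0 < x - s by rewrite /x; lra.
  apply: (le_trans (gamma_ratioN_le xs s01)).
  apply: ler_pM; rewrite ?invr_ge0 ?powR_ge0//.
  - by rewrite divr_ge0 ?(ltW xs)//; lra.
  - rewrite ler_pdivrMr// mulrAC ler_pdivlMr//.
    have : 1 + theta <= x by rewrite /x; lra.
    by move/(ler_wpM2l (ltW s0)); lra.
  - have cn0 : 0 < c0 * n%:R by rewrite mulr_gt0//; lra.
    have cx : c0 * n%:R <= x.
      rewrite /x; have [th|th] := leP 0 theta.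
        by have := ler_wpM2r (ler0n R n) c01; lra.
      have := ler_wpM2r (ler0n R n) c0t.
      by have := ler_wnM2l (ltW th) n1R; lra.
    rewrite lef_pV2 ?posrE ?powR_gt0//; last by lra.
    by apply: ge0_ler_powR; rewrite ?nnegrE ?(ltW s0) ?(ltW cn0)//; lra.
exists p => //; exists ((1 + `|b|) `^ p * (w 1%N / W 1%N) * K1 * (c0 `^ s)^-1).
  have wW0 : 0 < w 1%N / W 1%N by exact: divr_gt0.
  have b10 : 0 < 1 + `|b| by rewrite ltr_wpDr.
  apply: mulr_gt0; last by rewrite invr_gt0 powR_gt0.
  by apply: mulr_gt0 => //; apply: mulr_gt0 => //; exact: powR_gt0.
move=> n x n0 x1; have x0 : 0 < x by lra.
have lb := ler_norm b; have nb : 0 <= `|b| by [].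
have xb0 : 0 < x * (1 + `|b|) by rewrite mulr_gt0//; lra.
(* At most [x] vertices force [maxn v 1 + b <= x * (1 + |b|)], as [x >= 1]; the prefactor thus makes
   [F] at least 1 on the event. *)
pose F (es : network) : \bar R := (((x * (1 + `|b|)) `^ p)%:E * (w (nverts es))%:E)%E.
have F0 es : (0 <= F es)%E by rewrite mule_ge0// lee_fin ?powR_ge0// ltW.
apply: (le_trans (prob_Ynet_le hX n (A := [set es | (nverts es)%:R <= x]) F0 _)).
  move=> es /= vx; rewrite /F -EFinM lee_fin.
  have v0 := vert_arg_gt0 a0 ta (nverts es).
  have vp0 := vert_arg_p_gt0 q0 (nverts es).
  have vv : (maxn (nverts es) 1)%:R + b <= x * (1 + `|b|).
    have : (maxn (nverts es) 1)%:R <= x.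
      by rewrite /maxn; case: ifP.
    by have := ler_wpM2r nb x1; lra.
  have := gamma_ratioN_ge vp0 p01; rewrite -/(wvert alpha theta (- p) (nverts es)) -/w => H.
  rewrite -ler_pdivrMl ?powR_gt0// mulr1; apply: le_trans H.
  rewrite lef_pV2 ?posrE ?powR_gt0//.
  by apply: ge0_ler_powR; rewrite ?nnegrE ?(ltW p0) ?(ltW v0) ?(ltW xb0).
rewrite ge0_integralZl//=; last 3 first.
- exact: (measurable_fun_countType (measurable_Ynet hX n) (fun es => (w (nverts es))%:E)).
- by move=> t _; rewrite lee_fin ltW.
- by rewrite lee_fin powR_ge0.
rewrite (integral_wvert a0 a1 ta q0 n nu_ge0 hX) -/w -/W.
have Wn : (walk_exp nu n (EFin \o W) 0%N <= (K1 * ((c0 * n%:R) `^ s)^-1)%:E)%E.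
  apply: walk_exp_le_cst => //.
    by rewrite lee_fin mulr_ge0 ?invr_ge0 ?powR_ge0// ltW.
  by move=> i; rewrite add0n => ni; rewrite lee_fin Wle.
have wW : 0 <= w 1%N / W 1%N by rewrite divr_ge0 ?ltW.
apply: (@le_trans _ _ (((x * (1 + `|b|)) `^ p)%:E * ((w 1%N / W 1%N)%:E * (K1 * ((c0 * n%:R) `^ s)^-1)%:E))%E).
  by rewrite lee_wpmul2l ?lee_fin ?powR_ge0// lee_wpmul2l// lee_fin.
rewrite -!EFinM lee_fin !powRM ?(ltW c00) ?(ltW x0) ?addr_ge0// -/s.
rewrite le_eqVlt; apply/orP; left; apply/eqP; rewrite [(c0 `^ s * _)^-1]invfM; ring.
Qed.

End vertex_tail.

(** * Borel-Cantelli for geometrically small events *)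

Section borel_cantelli_geometric.
Context {R : realType} {d : measure_display} {T : measurableType d}.
Variable P : probability T R.

Lemma ae_eventually_not (A : nat -> set T) (K r : R) :
  (forall k, measurable (A k)) -> 0 <= K -> 0 < r < 1 ->
  (forall k, (P (A k) <= (K * r ^+ k)%:E)%E) ->
  {ae P, forall t, \forall k \near \oo, ~ A k t}.
Proof.
move=> mA K0 /andP[r0 r1] PA.
exists (lim_sup_set A); split.
- apply: bigcap_measurable => //.
  by move=> k _; apply: bigcup_measurable.
- apply: lim_sup_set_cvg0 => //.
  apply: (@le_lt_trans _ _ (K * (1 - r)^-1)%:E); last exact: ltry.
  apply: lime_le; first by apply: is_cvg_nneseries => k _ _; exact: measure_ge0.
  apply: nearW => n; apply: (@le_trans _ _ (\sum_(0 <= k < n) (K * r ^+ k)%:E)%E).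
    by apply: lee_sum => k _; exact: PA.
  rewrite sumEFin lee_fin.
  by apply: (@geometric_le_lim R n K r K0 r0); rewrite ger0_norm// ltW.
- move=> t /= nA n _ /=; apply: contrapT => H; apply: nA; exists n => // k /= nk Ak.
  by apply: H; exists k.
Qed.

End borel_cantelli_geometric.

(** * Sparsity *)

Section networks.
Context {R : realType}.

(** Each edge contributes at the single index [k] equal to its size; an empty edge contributes 0, so
    starting at 1 loses nothing. *)
Lemma sum_Mk (E : network) (M : nat) : all (fun x => size x <= M)%N E ->
  (\sum_(1 <= k < M.+1) k * Mk E k)%N = size (flatten E).
Proof.
elim: E => [|x E IH] /=; first by rewrite big1// => k _; rewrite muln0.
move=> /andP[xM EM]; rewrite size_cat -IH//.
transitivity (\sum_(1 <= k < M.+1) (k * (size x == k) + k * Mk E k))%N.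
  by apply: eq_bigr => k _; rewrite -mulnDr.
rewrite big_split/=; congr addn; have [->|x0] := posnP (size x).
  by rewrite big_nat big1// => k /andP[k1 _]; rewrite (ltn_eqF k1) muln0.
rewrite (bigD1_seq (size x)) ?iota_uniq//=; last by rewrite mem_index_iota x0 ltnS.
by rewrite eqxx muln1 big1 ?addn0// => k /negbTE; rewrite eq_sym => ->; rewrite muln0.
Qed.

Lemma mbulletE (E : network) :
  mbullet R E = (size (flatten E))%:R / (size E)%:R.
Proof.
rewrite /mbullet /nedges -natr_sum sum_Mk 1?mulrC//.
by apply/allP => x xE; rewrite /maxarity; exact: leq_bigmax_seq.
Qed.

Lemma leq_nverts_Ynet (T : Type) (X : nat -> T -> seq nat) t m n : (m <= n)%N ->
  (nverts (Ynet X m t) <= nverts (Ynet X n t))%N.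
Proof.
move=> mn; apply: uniq_leq_size (undup_uniq _) _ => x; rewrite !mem_undup /Ynet.
by rewrite -(subnKC mn) iotaD map_cat flatten_cat mem_cat => ->.
Qed.

Lemma size_Ynet (T : Type) (X : nat -> T -> seq nat) t n : size (Ynet X n t) = n.
Proof. by rewrite size_map size_iota. Qed.

(** The deterministic part. Monotonicity extends the bound from powers of 2 to [v >= y]^ b[with]y =
    n.+1 / 2[; the average arity is at least]a[, so the quotient is at most]2 * y [^ (1 - b * a)],
    which tends to 0. *)
Lemma limn_esup_sparse (Y : nat -> network) (a b : R) :
  0 < a -> 0 < b -> 1 < b * a ->
  (forall n, size (Y n) = n) ->
  (forall m n, (m <= n)%N -> (nverts (Y m) <= nverts (Y n))%N) ->
  (\forall n \near \oo, a * n%:R < (size (flatten (Y n)))%:R) ->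
  (\forall k \near \oo, (2 ^ k)%:R `^ b < (nverts (Y (2 ^ k)%N))%:R) ->
  limn_esup (fun n : nat =>
    ((nedges (Y n.+1))%:R / ((nverts (Y n.+1))%:R `^ mbullet R (Y n.+1)))%:E) = 0%E.
Proof.
move=> a0 b0 ba sY mY [N1 _ HN] [N2 _ HV].
have c0 : 0 < b * a - 1 by lra.
have C := @cvg_powR_inv R 2^-1 _ ltac:(by []) c0.
have {}C : 2 * (2^-1 * n.+1%:R)^-1 `^ (b * a - 1) @[n --> \oo] --> (0 : R).
  by rewrite -[X in _ --> X](mulr0 2); apply: cvgM => //; exact: cvg_cst.
suff H : ((nedges (Y n.+1))%:R / ((nverts (Y n.+1))%:R `^ mbullet R (Y n.+1)))%:E
    @[n --> \oo] --> (0 : R)%:E.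
  by rewrite is_cvg_limn_esupE; [exact: cvg_lim H|apply/cvg_ex; exists 0%E].
apply: cvg_EFin; first exact: nearW.
(* The three terms serve the arity bound, the vertex bound at the largest power of 2 up to [n.+1],
   and [y >= 1]. *)
apply: (squeeze_cvgr _ (cvg_cst 0) C); exists (N1 + 2 ^ N2 + 1)%N => // n /= nN.
apply/andP; split; first by rewrite divr_ge0 ?powR_ge0.
rewrite /nedges sY; set k := trunc_log 2 n.+1.
have [k1 k2] : (2 ^ k <= n.+1)%N /\ (n.+1 < 2 ^ k.+1)%N.
  by split; [exact: trunc_logP|exact: trunc_log_ltn].
have kN : (N2 <= k)%N.
  by apply: trunc_log_max => //; apply: leq_trans (leqnSn n); apply: leq_trans nN; rewrite -addnA addnCA leq_addr.
have nN1 : (N1 <= n.+1)%N by apply: leq_trans (leqnSn n); apply: leq_trans nN; rewrite -addnA leq_addr.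
have n1 : (1 <= n)%N by apply: leq_trans nN; rewrite leq_addl.
pose y : R := 2^-1 * n.+1%:R.
have y1 : 1 <= y.
  have : 2 <= n.+1%:R :> R by rewrite ler_nat ltnS.
  by rewrite /y; lra.
have y0 : 0 < y by lra.
have yk : y <= (2 ^ k)%:R.
  have : n.+1%:R <= (2 ^ k.+1)%:R :> R by rewrite ler_nat ltnW.
  by rewrite expnS natrM /y; lra.
have vy : y `^ b <= (nverts (Y n.+1))%:R.
  apply: (@le_trans _ _ ((2 ^ k)%:R `^ b)).
    by apply: ge0_ler_powR; rewrite ?nnegrE ?(ltW b0) ?(ltW y0).
  by apply: (le_trans (ltW (HV k kN))); rewrite ler_nat; exact: mY.
(* A base of at least 1 lets the exponent grow from [a] to the average arity. *)
have yb1 : 1 <= y `^ b by rewrite -[leLHS](powRr0 y); apply: ler_powR => //; exact: ltW.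
have am : a <= mbullet R (Y n.+1).
  by rewrite mbulletE sY ler_pdivlMr// ltW//; exact: HN.
have vm : y `^ (b * a) <= (nverts (Y n.+1))%:R `^ mbullet R (Y n.+1).
  rewrite powRrM; apply: (@le_trans _ _ ((y `^ b) `^ mbullet R (Y n.+1))).
    exact: ler_powR.
  by apply: ge0_ler_powR; rewrite ?nnegrE ?powR_ge0//; lra.
have n2 : n.+1%:R = 2 * y by rewrite /y mulrA divff// mul1r.
rewrite -/y n2 -mulrA ler_pM2l// invr_powR//.
rewrite powRB ?(gt_eqF y0) ?implybT// powRr1 ?(ltW y0)// invf_div.
have yba : 0 < y `^ (b * a) by rewrite powR_gt0.
by rewrite ler_pM2l// lef_pV2 ?posrE//; exact: lt_le_trans vm.
Qed.

End networks.

Section almost_sure.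
Context {R : realType} (alpha theta mu : R) (nu : nat -> R).
Hypotheses (a0 : 0 < alpha) (a1 : alpha < 1) (ta : - alpha < theta).
Hypotheses (nu_ge0 : forall k, 0 <= nu k) (nu0 : nu 0%N = 0).
Hypothesis nu_sum : (fun n => \sum_(0 <= k < n) nu k) @ \oo --> (1 : R).
Hypothesis nu_mean : (fun n => \sum_(0 <= k < n) k%:R * nu k) @ \oo --> mu.
Context {d : measure_display} {T : measurableType d} (P : probability T R).
Variable X : nat -> T -> seq nat.
Hypothesis hX : is_hollywood P alpha theta nu X.

Lemma ae_size_flatten_gt (a : R) : a < mu ->
  {ae P, forall t, \forall n \near \oo,
    a * n%:R < (size (flatten (Ynet X n t)))%:R}.
Proof.
move=> amu.
have [lam lam0 [rho rho01 H]] := walk_chernoff nu_ge0 nu_sum nu_mean amu.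
pose A n := [set t | (size (flatten (Ynet X n t)))%:R <= a * n%:R].
have mA n : measurable (A n).
  exact: (measurable_preimage_countType (measurable_Ynet hX n)
    [set es | (size (flatten es))%:R <= a * n%:R]).
have PA n : (P (A n) <= (1 * rho ^+ n)%:E)%E.
  rewrite mul1r; apply: le_trans (H n).
  pose F m := (expR (lam * (a * n%:R - m%:R)))%:E.
  rewrite -(integral_size_flatten a0 a1 ta nu_ge0 hX) => [|m]; last first.
    by rewrite lee_fin expR_ge0.
  apply: (prob_Ynet_le hX n (A := [set es | (size (flatten es))%:R <= a * n%:R])
    (F := fun es => F (size (flatten es)))) => [es|es /= Hes].
    by rewrite lee_fin expR_ge0.
  by rewrite lee_fin -[leLHS]expR0 ler_expR mulr_ge0 ?subr_ge0// ltW.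
have := ae_eventually_not mA ler01 rho01 PA.
apply: filterS => t; apply: filterS => n.
by rewrite /A/= => /negP; rewrite -ltNge.
Qed.

(** The tail bound with [x = n]^ b[decays only as the power]n [^ (- (alpha - b) * p)], perhaps not
    summably; along [n = 2 ^ k] it becomes geometric, with ratio [r]. *)
Lemma ae_nverts_gt (b : R) : 0 < b -> b < alpha ->
  {ae P, forall t, \forall k \near \oo,
    (2 ^ k)%:R `^ b < (nverts (Ynet X (2 ^ k) t))%:R}.
Proof.
move=> b0 ba.
have [p p0 [K K0 H]] := nverts_tail a0 a1 ta nu_ge0 nu0 nu_sum hX.
pose A k := [set t | (nverts (Ynet X (2 ^ k) t))%:R <= (2 ^ k)%:R `^ b].
have mA k : measurable (A k).
  exact: (measurable_preimage_countType (measurable_Ynet hX (2 ^ k))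
    [set es | (nverts es)%:R <= (2 ^ k)%:R `^ b]).
pose r : R := 2 `^ (b * p - alpha * p).
have r01 : 0 < r < 1.
  have s0 : 0 < (alpha - b) * p by rewrite mulr_gt0// subr_gt0.
  rewrite powR_gt0//= /r (_ : _ - _ = - ((alpha - b) * p)); last by ring.
  rewrite powRN invf_lt1 ?powR_gt0//.
  have := @gt0_ltr_powR R _ s0 1 2; rewrite powR1; apply; rewrite ?nnegrE//.
  by rewrite ltr1n.
have PA k : (P (A k) <= (K * r ^+ k)%:E)%E.
  have k1 : (0 < 2 ^ k)%N by rewrite expn_gt0.
  have k1R : 1 <= (2 ^ k)%:R :> R by rewrite ler1n.
  have x1 : 1 <= (2 ^ k)%:R `^ b.
    by rewrite -[leLHS](powRr0 (2 ^ k)%:R); apply: ler_powR => //; exact: ltW.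
  apply: (le_trans (H _ _ k1 x1)); rewrite lee_fin -mulrA ler_pM2l//.
  rewrite -powRrM -powRB; last by rewrite pnatr_eq0 -lt0n k1 implybT.
  by rewrite natrX -!powR_mulrn ?powR_ge0// -!powRrM mulrC.
have := ae_eventually_not mA (ltW K0) r01 PA.
apply: filterS => t; apply: filterS => n.
by rewrite /A/= => /negP; rewrite -ltNge.
Qed.

Lemma hollywood_sparse : mu^-1 < alpha ->
  {ae P, forall t,
    limn_esup (fun n : nat =>
      ((nedges (Ynet X n.+1 t))%:R
       / ((nverts (Ynet X n.+1 t))%:R `^ mbullet R (Ynet X n.+1 t)))%:E) = 0%E}.
Proof.
move=> muV; have mu1 := mean_ge1 nu_ge0 nu_sum nu_mean nu0.
have mu0 : 0 < mu by lra.
(* Two midpoints: [b] lies between [mu^-1] and [alpha], so [b^-1 < mu]; then [a] lies between [b^-1]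
   and [mu], so [b * a > 1]. *)
pose b := (alpha + mu^-1) / 2.
have muV0 : 0 < mu^-1 by rewrite invr_gt0.
have b0 : 0 < b by rewrite /b; lra.
have ba : b < alpha by rewrite /b; lra.
have bmu : b^-1 < mu by rewrite -[mu]invrK ltf_pV2 ?posrE//; rewrite /b; lra.
pose a := (mu + b^-1) / 2.
have bV0 : 0 < b^-1 by rewrite invr_gt0.
have a0' : 0 < a by rewrite /a; lra.
have amu : a < mu by rewrite /a; lra.
have ab : 1 < b * a.
  by rewrite mulrC -ltr_pdivrMr// mul1r /a; lra.
have H1 := ae_size_flatten_gt amu; have H2 := ae_nverts_gt b0 ba.
apply: filterS2 H1 H2 => t Ht1 Ht2.
apply: (@limn_esup_sparse R (fun n => Ynet X n t) a b) => // [n|m n].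
- exact: size_Ynet.
- exact: leq_nverts_Ynet.
Qed.

End almost_sure.

Unset Implicit Arguments.
Set Strict Implicit.

Theorem theorem5p3 (R : realType) (d : measure_display) (T : measurableType d)
    (P : probability T R) (alpha theta mu : R) (nu : nat -> R)
    (X : nat -> T -> seq nat) :
  0 < alpha -> alpha < 1 -> - alpha < theta ->
  (forall k, 0 <= nu k) -> nu 0%N = 0 ->
  (fun n => \sum_(0 <= k < n) nu k) @ \oo --> (1 : R) ->
  (fun n => \sum_(0 <= k < n) k%:R * nu k) @ \oo --> mu ->
  is_hollywood P alpha theta nu X ->
  ((fun n : nat =>
      fine ('E_P[fun t => (nverts (Ynet X n.+1 t))%:R])%E
      / (Gamma (theta + 1) / (alpha * Gamma (theta + alpha))
         * (mu * n.+1%:R) `^ alpha)) @ \oo --> (1 : R))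
  /\
  (mu^-1 < alpha ->
     {ae P, forall t,
        limn_esup (fun n : nat =>
          ((nedges (Ynet X n.+1 t))%:R
           / ((nverts (Ynet X n.+1 t))%:R `^ mbullet R (Ynet X n.+1 t)))%:E) = 0%E}).
Proof.
move=> a0 a1 ta nu_ge0 nu0 nu_sum nu_mean hX; split.
  exact: (expectation_nverts_equiv a0 a1 ta nu_ge0 nu0 nu_sum nu_mean hX).
exact: (hollywood_sparse a0 a1 ta nu_ge0 nu0 nu_sum nu_mean hX).
Qed.
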